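(* Let $\delta\ge0$ and $\lambda\ge0$, and let $G^2=(G^2_1,G^2_2)$ be the two-particle gap process on $\mathbb{N}^2$ with parameters $\delta,\lambda$. Then $G^2$ is exponentially ergodic if and only if $\lambda>2\delta^2+4\delta$. Moreover, when it exists, the unique stationary (probability) measure $\pi_2$ of $G^2$ has the explicit form $$\pi_2(0,0)=\frac C2,$$ $$\pi_2(0,y)=C\left(\frac{1+\delta}{1+\frac\lambda2}\right)^{y}\quad (y\ge1),$$ $$\pi_2(x,0)=\frac C2\left(\frac{(1+\delta)^2}{1+\frac\lambda2}\right)^{x}\quad (x\ge1),$$ $$\pi_2(x,y)=C\left(\frac{(1+\delta)^2}{1+\frac\lambda2}\right)^{x}\left(\frac{1+\delta}{1+\frac\lambda2}\right)^{y}\quad (x\ge1,\ y\ge1),$$ where $$C:=\frac{2\left(\frac\lambda2-\delta\right)\left(\frac\lambda2-2\delta-\delta^2\right)}{\left(\frac\lambda2+\delta+2\right)\left(\frac\lambda2+1\right)}.$$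
   Context: $\mathbb{N}=\{0,1,2,\dots\}$. The gap process $G^2=\{(G^2_1(t),G^2_2(t))\}_{t\ge0}$ is the continuous-time Markov chain on $\mathbb{N}^2$ with the following jumps from $\mathbf g=(g_1,g_2)$: - If $g_1>0$ and $g_2>0$: to $\mathbf g+(1,-1)$ at rate $1+\delta$; to $\mathbf g+(0,-1)$ at rate $1+\frac\lambda2$; to $\mathbf g+(-1,1)$ at rate $1$; to $\mathbf g+(0,1)$ at rate $1+\delta$. - If $g_1=0$ and $g_2>0$: to $\mathbf g+(1,-1)$ at rate $1+\delta$; to $\mathbf g+(0,-1)$ at rate $1+\frac\lambda2$; to $\mathbf g+(0,1)$ at rate $1+\delta$. - If $g_1>0$ and $g_2=0$: to $\mathbf g+(-1,1)$ at rate $2$; to $\mathbf g+(0,1)$ at rate $2+2\delta$. - If $g_1=g_2=0$: to $(0,1)$ at rate $2+2\delta$. (It describes the position of the lowest particle and the distance between the two particles in the small jump system of $N=2$ interacting walkers: each walker jumps $+1$ at rate $1+\delta$ and, if its position is positive, $-1$ at rate $1+\frac\lambda2\cdot\#\{\text{walkers strictly below it}\}$.) Exponential ergodicity of a continuous-time Markov chain on a countable set $S$ means: there exist a unique probability measure $\pi$ on $S$ and a constant $\rho<1$ such that for every initial state $x\in S$ there is a finite constant $C(x)$ with $\|P_x(\text{state at time }t\in\cdot)-\pi\|_{TV}\le C(x)\rho^t$ for all $t>0$. *)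

(* Defs.v *)
From HB Require Import structures.
From mathcomp Require Import all_boot all_order all_algebra.
From mathcomp Require Import all_classical all_reals all_analysis.
Set Implicit Arguments.
Unset Strict Implicit.
Unset Printing Implicit Defensive.
Import Order.TTheory GRing.Theory Num.Theory.
Import numFieldNormedType.Exports.
Local Open Scope classical_set_scope.
Local Open Scope ring_scope.

(* [nat * nat] carries the product of the discrete sigma-algebras on [nat],
   in which every set is measurable. *)
Notation state := (nat * nat)%type.

Section continuous_time_chains.
Context {R : realType} {d : measure_display} {Omega : measurableType d}.
Implicit Types (Pr : state -> probability Omega R)
               (X : R -> {mfun Omega >-> state}).

Definition law Pr X (t : R) (x : state) : probability state R :=
  distribution (Pr x) (X t).

Definition past X (s : R) : set (set Omega) :=
  <<s [set F | exists u : R, exists A : set state,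
         [/\ 0 <= u <= s, measurable A & F = X u @^-1` A]] >>.

(* [jumps x] lists the jumps available from [x], as pairs (target, rate);
   no target is [x] itself. *)
Definition generator (jumps : state -> seq (state * R)) (x y : state) : R :=
  \sum_(j <- jumps x | j.1 == y) j.2 -
  (if x == y then \sum_(j <- jumps x) j.2 else 0).

(* [Pr x] is the probability P_x under which the chain starts at [x]. Times are
   nonnegative, so [X t] is irrelevant for [t < 0]. No regularity of the paths
   is required: only the laws matter here. *)
Definition is_markov_chain (jumps : state -> seq (state * R)) Pr X : Prop :=
  [/\ forall x, Pr x (X 0 @^-1` [set x]) = 1%E,
      (forall x (s t : R) (F : set Omega) (A : set state),
         0 <= s -> 0 <= t -> past X s F -> measurable A ->
         Pr x (F `&` X (s + t) @^-1` A) =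
         (\int[Pr x]_(w in F) law Pr X t (X s w) A)%E)
    & forall x y : state,
        (fine (law Pr X h x [set y]) - (x == y)%:R) / h
          @[h --> 0^'+] --> generator jumps x y].

Definition tv_dist (mu nu : probability state R) : \bar R :=
  ereal_sup [set `|mu A - nu A|%E | A in [set A | measurable A]].

Definition converges_exponentially Pr X (pi : probability state R) (rho : R) :=
  forall x : state, exists C : R, forall t : R, 0 < t ->
    (tv_dist (law Pr X t x) pi <= (C * rho `^ t)%:E)%E.

(* [rho `^ t] is only meaningful for a nonnegative base, hence [0 <= rho]. *)
Definition exponential_limit Pr X (pi : probability state R) : Prop :=
  exists2 rho : R, 0 <= rho < 1 & converges_exponentially Pr X pi rho.

Definition exponentially_ergodic Pr X : Prop :=
  exists2 pi : probability state R, exponential_limit Pr X pi &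
    forall pi' : probability state R, exponential_limit Pr X pi' ->
      forall A, measurable A -> pi' A = pi A.

Definition stationary Pr X (pi : probability state R) : Prop :=
  forall (t : R) (A : set state), 0 <= t -> measurable A ->
    (\int[pi]_x law Pr X t x A)%E = pi A.

End continuous_time_chains.

Definition gap_jumps {R : realType} (delta lambda : R) (g : state) :
    seq (state * R) :=
  match g with
  | (a.+1, b.+1) => [:: ((a.+2, b), 1 + delta);
                        ((a.+1, b), 1 + lambda / 2);
                        ((a, b.+2), 1);
                        ((a.+1, b.+2), 1 + delta)]
  | (0%N, b.+1)  => [:: ((1%N, b), 1 + delta);
                        ((0%N, b), 1 + lambda / 2);
                        ((0%N, b.+2), 1 + delta)]
  | (a.+1, 0%N)  => [:: ((a, 1%N), 2);
                        ((a.+1, 1%N), 2 + 2 * delta)]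
  | (0%N, 0%N)   => [:: ((0%N, 1%N), 2 + 2 * delta)]
  end.

Definition is_gap_process {R : realType} {d : measure_display}
    {Omega : measurableType d} (delta lambda : R)
    (Pr : state -> probability Omega R) (G : R -> {mfun Omega >-> state}) :=
  is_markov_chain (gap_jumps delta lambda) Pr G.

Definition gap_const {R : realType} (delta lambda : R) : R :=
  2 * (lambda / 2 - delta) * (lambda / 2 - 2 * delta - delta ^+ 2) /
  ((lambda / 2 + delta + 2) * (lambda / 2 + 1)).

(* Main.v *)
Require Import Defs.
From HB Require Import structures.
From mathcomp Require Import all_boot all_order all_algebra.
From mathcomp Require Import all_classical all_reals all_analysis.
From mathcomp Require Import ring lra zify.
Import Order.TTheory GRing.Theory Num.Theory.
Import numFieldNormedType.Exports.
Local Open Scope classical_set_scope.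
Local Open Scope ring_scope.
Set Implicit Arguments.
Unset Strict Implicit.
Unset Printing Implicit Defensive.

(** The chain enters only through its transition probabilities
    [P t x = law Pr G t x]: they satisfy the Chapman-Kolmogorov equation and
    have the prescribed derivative at time 0, and the total jump rate out of a
    state is bounded by a constant [K]. The argument has four steps.

    _Invariance is a finite balance equation._ From the derivative at 0 alone
    one gets, uniformly over the states,
    [P t x {x} >= 1 - exit x * t] (subadditivity of the probability of having
    left) and, as long as [K t <= 1],
    [P t x {y} >= t * q x y * (1 - K t)^2] ([mass_jump_ge]). If a probability
    [pi] is invariant, these bounds give inflow <= outflow at each state; the
    total mass being finite, the total inflow is the total outflow, so
    equality holds everywhere ([subbalanced_balanced], [invariant_balanced]).
    Conversely, for balanced [pi] and small [h] the same bounds give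
    [pi P_h >= (1 - 2 K^2 h^2) pi]; iterating over [n] steps of length [t / n]
    loses only [2 K^2 t^2 / n], whence [pi P_t >= pi], and complements turn
    this into equality ([balanced_invariant]).

    _Uniqueness._ Since every state leads to the origin, a nonnegative
    balanced weight that vanishes at the origin vanishes everywhere. If [u] is
    balanced with finite mass and [v] is balanced, then [min (v, c u)]
    receives at most what it sends, hence is balanced, and choosing [c] so
    that [v] and [c u] agree at the origin forces [v = c u]
    ([balanced_unique]). The explicit weight [gap_weight] is balanced for all
    parameters; so an invariant probability exists only if that weight has
    finite mass, which happens exactly when
    [(1 + delta)^2 < 1 + lambda / 2], and it is then the normalized weight
    ([gap_mass]). As an exponential limit is invariant
    ([exponential_rate_invariant]), ergodicity implies the inequality on the
    parameters.

    _Spectral gap._ If the inequality holds, the invariant probability is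
    comparable with a product of two geometric weights, and a discrete Hardy
    inequality on each axis gives a Poincare inequality ([poincare]) bounding
    the variance by the mean squared increments in the two coordinate
    directions. Over a fixed time [h] the chain stays put, moves up, or moves
    right, each with a probability bounded below ([gap_mass_bounds]); the
    conditional variance under [P h x] therefore dominates these squared
    increments, so [P h] contracts centred functions in L2([pi])
    ([contraction_step]).

    _From L2 to total variation._ Applied to [x |-> P s x A - pi A], the
    contraction yields [pi {x} * (P (n h + s) x A - pi A)^2 <= theta^n]
    uniformly in [A] and in [0 <= s], which is the required exponential rate
    because [pi {x} > 0] ([exponential_decay]). *)

(** * Sums over finite sets of states and means of bounded functions *)

Definition box (N : nat) : seq state :=
  [seq (a, b) | a <- iota 0 N, b <- iota 0 N].

Arguments box : simpl never.

Lemma mem_box N (x : state) : (x \in box N) = (x.1 < N)%N && (x.2 < N)%N.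
Proof.
case: x => a b; apply/allpairsP/idP => [[[c e] /= [+ + [-> ->]]]|/andP[/= aN bN]].
  by rewrite !mem_iota !add0n /= => -> ->.
by exists (a, b); rewrite !mem_iota.
Qed.

Lemma box_uniq N : uniq (box N).
Proof. by apply: allpairs_uniq; rewrite ?iota_uniq// => -[? ?] [? ?]. Qed.

Lemma sum_box (R : realType) N (F : state -> R) :
  \sum_(x <- box N) F x = \sum_(0 <= a < N) \sum_(0 <= b < N) F (a, b).
Proof.
by rewrite big_allpairs /index_iota !subn0.
Qed.

Lemma le_sum_subset (R : realDomainType) (I : eqType) (s1 s2 : seq I) (F : I -> R) :
  uniq s1 -> uniq s2 -> {subset s1 <= s2} -> (forall i, 0 <= F i) ->
  \sum_(i <- s1) F i <= \sum_(i <- s2) F i.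
Proof.
move=> u1 u2 s12 F0; rewrite [leRHS](bigID (mem s1))/=.
rewrite [X in _ <= X + _](_ : _ = \sum_(i <- s1) F i).
  by rewrite lerDl sumr_ge0.
rewrite -big_filter; apply: perm_big; apply: uniq_perm => //.
  exact: filter_uniq.
by move=> i; rewrite mem_filter /=; case: (boolP (i \in s1)) => //= /s12.
Qed.

Lemma sum_ge_term (R : realDomainType) (I : eqType) (s : seq I) (F : I -> R) i :
  uniq s -> i \in s -> (forall i, 0 <= F i) -> F i <= \sum_(i <- s) F i.
Proof.
move=> us si F0; rewrite -[F i](big_seq1 (@GRing.add R) i F).
by apply: le_sum_subset => // j; rewrite inE => /eqP ->.
Qed.

Lemma measurable_state (A : set state) : measurable A.
Proof.
rewrite (_ : A = \bigcup_(a in [set: nat]) \bigcup_(b in [set b | A (a, b)])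
    ([set a] `*` [set b])).
  apply: bigcup_measurable => // a _; apply: bigcup_measurable => // b _.
  exact: measurableX.
apply/seteqP; split => [[a b] Aab|[a b] [c _ [e /= Ace] [/= -> ->]]//].
by exists a => //; exists b.
Qed.

Lemma measurable_fun_state d' (T : measurableType d') (D : set state)
  (f : state -> T) : measurable_fun D f.
Proof. by move=> _ Y _; exact: measurable_state. Qed.

#[local] Hint Resolve measurable_state measurable_fun_state : core.

Definition bdd (R : realType) (f : state -> R) :=
  exists M : R, forall x, `|f x| <= M.

Section means.
Context {R : realType}.
Implicit Types (mu : probability state R) (f g : state -> R).

Definition mass mu (x : state) : R := fine (mu [set x]).

Definition mean mu f : R := (\int[mu]_x f x)%R.

Lemma bdd_cst c : bdd (fun _ => c : R).
Proof. by exists `|c|. Qed.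

Lemma bddD f g : bdd f -> bdd g -> bdd (fun x => f x + g x).
Proof.
move=> [M fM] [N gN]; exists (M + N) => x.
by rewrite (le_trans (ler_normD _ _))// lerD.
Qed.

Lemma bddN f : bdd f -> bdd (fun x => - f x).
Proof. by move=> [M fM]; exists M => x; rewrite normrN. Qed.

Lemma bddB f g : bdd f -> bdd g -> bdd (fun x => f x - g x).
Proof. by move=> bf bg; apply: bddD => //; exact: bddN. Qed.

Lemma bddM f g : bdd f -> bdd g -> bdd (fun x => f x * g x).
Proof.
move=> [M fM] [N gN]; exists (M * N) => x.
by rewrite normrM ler_pM.
Qed.

Lemma bdd_sqr f : bdd f -> bdd (fun x => f x ^+ 2).
Proof. by move=> bf; exact: (bddM bf bf). Qed.

Lemma bdd01 f : (forall x, 0 <= f x <= 1) -> bdd f.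
Proof. by move=> f01; exists 1 => x; have /andP[f0 f1] := f01 x; rewrite ger0_norm. Qed.

Lemma integrable_bdd mu f : bdd f -> mu.-integrable setT (EFin \o f).
Proof.
move=> [M fM]; apply: measurable_bounded_integrable => //.
  by apply: (le_lt_trans (probability_le1 mu _)) => //; exact: ltry.
exists M; split; first exact: num_real.
by move=> M' MM' x _ /=; rewrite (le_trans (fM x))// ltW.
Qed.

Lemma EFin_mean mu f : bdd f -> (mean mu f)%:E = (\int[mu]_x (f x)%:E)%E.
Proof.
by move=> bf; rewrite /mean /Rintegral fineK// integrable_fin_num//; exact: integrable_bdd.
Qed.

Lemma mean_cst mu c : mean mu (fun _ => c) = c.
Proof.
rewrite /mean Rintegral_cst// -[RHS]mulr1; congr (_ * _).
by rewrite -[RHS]/(fine 1%E); congr fine; exact: probability_setT.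
Qed.

Lemma meanD mu f g : bdd f -> bdd g ->
  mean mu (fun x => f x + g x) = mean mu f + mean mu g.
Proof. by move=> ? ?; rewrite /mean RintegralD//; exact: integrable_bdd. Qed.

Lemma meanB mu f g : bdd f -> bdd g ->
  mean mu (fun x => f x - g x) = mean mu f - mean mu g.
Proof. by move=> ? ?; rewrite /mean RintegralB//; exact: integrable_bdd. Qed.

Lemma meanZ mu c f : bdd f -> mean mu (fun x => c * f x) = c * mean mu f.
Proof. by move=> ?; rewrite /mean RintegralZl//; exact: integrable_bdd. Qed.

Lemma le_mean mu f g : bdd f -> bdd g -> (forall x, f x <= g x) ->
  mean mu f <= mean mu g.
Proof. by move=> ? ? fg; apply: le_Rintegral => //; exact: integrable_bdd. Qed.

Lemma mean_ge0 mu f : (forall x, 0 <= f x) -> 0 <= mean mu f.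
Proof. by move=> f0; apply: Rintegral_ge0. Qed.

Lemma mass_ge0 mu x : 0 <= mass mu x.
Proof. exact: fine_ge0. Qed.

Lemma EFin_prob mu (A : set state) : (fine (mu A))%:E = mu A.
Proof. by rewrite fineK// fin_num_measure. Qed.

Lemma prob01 mu (A : set state) : 0 <= fine (mu A) <= 1.
Proof. by rewrite fine_ge0//= -lee_fin EFin_prob probability_le1. Qed.

Lemma fine_setC mu (A : set state) : fine (mu (~` A)) = 1 - fine (mu A).
Proof.
by apply: EFin_inj; rewrite EFinB !EFin_prob probability_setC.
Qed.

Lemma bdd_mean (p : state -> probability state R) f :
  bdd f -> bdd (fun x => mean (p x) f).
Proof.
move=> [M fM]; exists M => x; have bf : bdd f by exists M.
rewrite ler_norml; apply/andP; split.
  rewrite -(mean_cst (p x) (- M)); apply: le_mean => //; first exact: bdd_cst.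
  by move=> y; have := fM y; rewrite ler_norml => /andP[].
rewrite -(mean_cst (p x) M); apply: le_mean => //; first exact: bdd_cst.
by move=> y; have := fM y; rewrite ler_norml => /andP[].
Qed.

Lemma integral_point mu f x : (forall y, 0 <= f y) ->
  (\int[mu]_(y in [set x]) (f y)%:E = (mass mu x * f x)%:E)%E.
Proof.
move=> f0; rewrite (eq_integral (fun=> (f x)%:E)) => [|y]; last first.
  by rewrite inE => ->.
by rewrite integral_cst// EFinM EFin_prob muleC.
Qed.

Lemma integral_seq mu f (s : seq state) : uniq s -> (forall y, 0 <= f y) ->
  (\int[mu]_(y in [set` s]) (f y)%:E = (\sum_(x <- s) mass mu x * f x)%:E)%E.
Proof.
move=> us f0; rewrite [in LHS](_ : [set` s] = \big[setU/set0]_(x <- s) [set x]).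
  rewrite ge0_integral_bigsetU//; first last.
  - by move=> x _; rewrite lee_fin.
  - by apply/trivIsetP => i j _ _ /eqP ij; rewrite -subset0 => k [/= -> /ij].
  by rewrite -sumEFin; apply: eq_bigr => x _; rewrite integral_point.
by rewrite -bigcup_seq bigcup_imset1 image_id.
Qed.

Lemma sum_le_mean mu f (s : seq state) : uniq s -> bdd f ->
  (forall y, 0 <= f y) -> \sum_(x <- s) mass mu x * f x <= mean mu f.
Proof.
move=> us bf f0; rewrite -lee_fin -integral_seq// EFin_mean//.
by apply: ge0_subset_integral => // x _; rewrite lee_fin.
Qed.

(** Monotone convergence along the boxes, which exhaust the states. Together
    with [sum_le_mean] it reduces every later estimate of a mean to finite
    sums. *)
Lemma mean_le_box mu f (M : R) : bdd f -> (forall y, 0 <= f y) ->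
  (forall N, \sum_(x <- box N) mass mu x * f x <= M) -> mean mu f <= M.
Proof.
move=> bf f0 fM; rewrite -lee_fin EFin_mean//.
have -> : [set: state] = \bigcup_N [set` box N].
  apply/seteqP; split => // x _; exists (maxn x.1 x.2).+1 => //=.
  by rewrite mem_box !ltnS leq_maxl leq_maxr.
have cv : (\int[mu]_(x in [set` box N]) (f x)%:E)%E @[N --> \oo] -->
    (\int[mu]_(x in \bigcup_N [set` box N]) (f x)%:E)%E.
  apply: ge0_nondecreasing_set_cvg_integral => //.
  - move=> m n mn; apply/subsetPset => x /=; rewrite !mem_box => /andP[xm ym].
    by rewrite !(leq_trans _ mn).
  - by move=> i _ Y _; exact: measurable_state.
  - by move=> i x _; rewrite lee_fin.
rewrite -(cvg_lim _ cv)//; apply: lime_le; first by apply/cvg_ex; eexists; exact: cv.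
by apply: nearW => N; rewrite integral_seq ?box_uniq// lee_fin.
Qed.

Lemma mean_indic mu (A : set state) : mean mu (fun x => \1_A x) = fine (mu A).
Proof.
apply: EFin_inj; rewrite EFin_prob EFin_mean; last first.
  by apply: bdd01 => x; rewrite indicE ler0n lern1 leq_b1.
by rewrite integral_indic// setIT.
Qed.
End means.

(** * Short-time bounds on transition probabilities *)

(** A box that contains every state at distance at most 1 from [x] in both
    coordinates. It is used on both sides of a jump, so that the exit rates and
    the inflows are finite sums. *)
Definition nbhd (x : state) : seq state := box (maxn x.1 x.2).+2.

Arguments nbhd : simpl never.

Lemma nbhd_refl x : x \in nbhd x.
Proof. by rewrite mem_box !ltnS !leqW// ?leq_maxl ?leq_maxr. Qed.

Lemma nbhd_uniq x : uniq (nbhd x). Proof. exact: box_uniq. Qed.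

Section rates.
Context {R : realType}.
Implicit Types (q : state -> state -> R) (w : state -> R).

Definition exit q x : R := \sum_(y <- nbhd x) q x y.

Definition inflow q w y : R := \sum_(x <- nbhd y) w x * q x y.

Definition local_rates q (K : R) :=
  [/\ forall x y, 0 <= q x y, forall x, q x x = 0,
      forall x y, q x y != 0 -> y \in nbhd x /\ x \in nbhd y
    & forall x, exit q x <= K].

Definition transition_function q (P : R -> state -> probability state R) :=
  [/\ forall x, mass (P 0 x) x = 1,
      forall (s t : R) x (A : set state), 0 <= s -> 0 <= t ->
        P (s + t) x A = (\int[P s x]_z P t z A)%E
    & forall x y : state, (mass (P h x) y - (x == y)%:R) / h
        @[h --> 0^'+] --> q x y - (x == y)%:R * exit q x].

End rates.

Lemma exists_fraction_lt (R : realType) (t e : R) : 0 <= t -> 0 < e ->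
  exists n : nat, t / n.+1%:R < e.
Proof.
move=> t0 e0; exists (Num.truncn (t / e)).
rewrite ltr_pdivrMr// mulrC -ltr_pdivrMr//.
exact: truncnS_gt.
Qed.

(** Cutting [0, t] into [n] equal pieces bounds [f t] by [n * f (t / n)], and
    [n * f (t / n)] is close to [t] times the slope at 0. *)
Lemma subadditive_le_slope (R : realType) (f : R -> R) (l : R) :
  (forall s t, 0 <= s -> 0 <= t -> f (s + t) <= f s + f t) ->
  (forall e, 0 < e -> exists2 h0, 0 < h0 &
     forall h, 0 < h < h0 -> f h <= (l + e) * h) ->
  forall t, 0 < t -> f t <= l * t.
Proof.
move=> fD fl t t0.
have f_mul h n : 0 <= h -> f (n.+1%:R * h) <= n.+1%:R * f h.
  move=> h0; elim: n => [|n ih]; first by rewrite !mul1r.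
  rewrite -[in leLHS]natr1 -[in leRHS]natr1 !mulrDl !mul1r.
  rewrite (le_trans (fD _ _ _ _))//; first by rewrite mulr_ge0.
  by rewrite lerD2r.
apply/ler_addgt0Pr => e e0.
have [h0 h00 fh0] := fl (e / t) (divr_gt0 e0 t0).
have [n tn] := exists_fraction_lt (ltW t0) h00.
have tn0 : 0 < t / n.+1%:R by rewrite divr_gt0.
have tE : t = n.+1%:R * (t / n.+1%:R) by rewrite mulrC divfK.
rewrite [in leLHS]tE (le_trans (f_mul _ _ (ltW tn0)))//.
have -> : l * t + e = n.+1%:R * ((l + e / t) * (t / n.+1%:R)).
  have k0 : n.+1%:R != 0 :> R by rewrite pnatr_eq0.
  by move: (n.+1%:R) k0 => k k0; field; rewrite k0 gt_eqF.
by rewrite ler_wpM2l// fh0// tn0 tn.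
Qed.

Lemma at_right_near (R : realType) (f : R -> R) (l : R) :
  f h @[h --> 0^'+] --> l ->
  forall e, 0 < e -> exists2 h0, 0 < h0 &
    forall h, 0 < h < h0 -> `|f h - l| < e.
Proof.
move=> /cvgrPdist_lt fl e e0.
have [h0 /= h00 H] := fl e e0.
exists h0 => // h /andP[hp hh]; rewrite distrC; apply: H => //=.
by rewrite sub0r normrN gtr0_norm.
Qed.

Section transition.
Context {R : realType}.
Variables (q : state -> state -> R) (K : R).
Variable P : R -> state -> probability state R.
Hypotheses (qK : local_rates q K) (Pq : transition_function q P).
Implicit Types (s t : R) (x y z : state).

Let q0 x y : 0 <= q x y. Proof. by case: qK. Qed.
Let qd x : q x x = 0. Proof. by case: qK. Qed.
Let qn x y : q x y != 0 -> y \in nbhd x /\ x \in nbhd y.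
Proof. by case: qK => _ _ + _; exact. Qed.
Let exitK x : exit q x <= K. Proof. by case: qK. Qed.

Lemma exit_ge0 x : 0 <= exit q x. Proof. exact: sumr_ge0. Qed.

Lemma rate_bound_ge0 : 0 <= K.
Proof. exact: le_trans (exit_ge0 (0, 0)%N) (exitK _). Qed.

Lemma bdd_prob t (A : set state) : bdd (fun z => fine (P t z A)).
Proof. by apply: bdd01 => z; exact: prob01. Qed.

Lemma chapman_kolmogorov s t x (A : set state) : 0 <= s -> 0 <= t ->
  fine (P (s + t) x A) = mean (P s x) (fun z => fine (P t z A)).
Proof.
move=> s0 t0; apply: EFin_inj; rewrite EFin_prob EFin_mean; last exact: bdd_prob.
case: Pq => _ -> // _; apply: eq_integral => z _.
by rewrite EFin_prob.
Qed.

Lemma chapman_kolmogorov_ge s t x (A : set state) (B : seq state) :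
  0 <= s -> 0 <= t -> uniq B ->
  \sum_(z <- B) mass (P s x) z * fine (P t z A) <= fine (P (s + t) x A).
Proof.
move=> s0 t0 uB; rewrite chapman_kolmogorov//.
apply: sum_le_mean => //; first exact: bdd_prob.
by move=> z; case/andP: (prob01 (P t z) A).
Qed.

Lemma mass_le1 mu x : mass (mu : probability state R) x <= 1.
Proof. by case/andP: (prob01 mu [set x]). Qed.

Lemma mass_step1 s t x y z : 0 <= s -> 0 <= t ->
  mass (P s x) z * mass (P t z) y <= mass (P (s + t) x) y.
Proof.
move=> s0 t0.
by have := chapman_kolmogorov_ge x [set y] s0 t0 (isT : uniq [:: z]); rewrite big_seq1.
Qed.

Lemma mass_step2 s t x y : 0 <= s -> 0 <= t -> x != y ->
  mass (P s x) x * mass (P t x) y + mass (P s x) y * mass (P t y) y <=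
  mass (P (s + t) x) y.
Proof.
move=> s0 t0 xy.
have u : uniq [:: x; y] by rewrite /= inE xy.
by have := chapman_kolmogorov_ge x [set y] s0 t0 u; rewrite !big_cons big_nil addr0.
Qed.

(** The function [t |-> 1 - P t x {x}] is subadditive, because staying at [x]
    at times [s] and [s + t] is one way of being at [x] at time [s + t]; its
    slope at 0 is the exit rate. *)
Lemma mass_stay_ge t x : 0 <= t -> 1 - exit q x * t <= mass (P t x) x.
Proof.
rewrite le_eqVlt => /predU1P[<-|t0].
  by rewrite mulr0 subr0; case: Pq => ->.
rewrite lerBlDl -lerBlDr.
apply: (@subadditive_le_slope R (fun t => 1 - mass (P t x) x)) => // [s u s0 u0|e e0].
  have := mass_step1 x x x s0 u0.
  have := mass_le1 (P s x) x; have := mass_le1 (P u x) x.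
  set a := mass _ _; set b := mass _ _; set c := mass _ _ => *; nra.
case: Pq => _ _ /(_ x x)/at_right_near/(_ e e0)[h0 h00 H].
exists h0 => // h hh; have := H _ hh; rewrite eqxx qd mulr1n mul1r ltr_norml.
have h1 : 0 < h by case/andP: hh.
move=> /andP[+ _]; rewrite ltrBrDr ltr_pdivlMr//.
set m := mass _ _ => *; nra.
Qed.

(** Discrete version of [mass_jump_ge] on a grid of mesh [h]. During one more
    step the chain either is still at [x] and jumps to [y], or already is at
    [y] and stays there, both stays being controlled by [mass_stay_ge]. *)
Lemma mass_jump_iter t h n m x y : x != y -> 0 < h -> K * t <= 1 ->
  n.+1%:R * h = t -> (m <= n.+1)%N ->
  m%:R * mass (P h x) y * (1 - K * t) * (1 - K * (m%:R * h)) <=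
  mass (P (m%:R * h) x) y.
Proof.
move=> xy h0 Kt nht; have K0 := rate_bound_ge0.
elim: m => [|m ih] mn; first by rewrite !mul0r mass_ge0.
have {}ih := ih (ltnW mn).
have mh0 : 0 <= m%:R * h by rewrite mulr_ge0// ltW.
have mht : m.+1%:R * h <= t by rewrite -nht ler_wpM2r ?ler_nat// ltW.
move: mht ih; rewrite -natr1 mulrDl mul1r.
have := mass_step2 mh0 (ltW h0) xy.
have := mass_stay_ge x mh0; have := mass_stay_ge y (ltW h0).
have := exitK x; have := exitK y.
have : 0 <= mass (P h x) y by exact: mass_ge0.
have : 0 <= (m%:R : R) by [].
move: mh0.
set ex := exit q x; set ey := exit q y.
set a := mass (P (_ * _) x) y; set p := mass (P h x) y.
set sx := mass (P (_ * _) x) x; set sy := mass (P h y) y.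
set k : R := m%:R.
move=> kh0 k0 p0 eyK exK sy_ge sx_ge step kht ih.
have sx1 : 1 - K * t <= sx by nra.
have sy1 : 1 - K * h <= sy by nra.
have Kh : K * h <= 1 by nra.
have : 0 <= a by exact: mass_ge0.
move=> a0; apply: le_trans step.
apply: (@le_trans _ _ ((1 - K * t) * p +
    k * p * (1 - K * t) * (1 - K * (k * h)) * (1 - K * h))).
  have : 0 <= (1 - K * t) * p by apply: mulr_ge0 => //; rewrite subr_ge0.
  set c := (1 - K * t) * p => c0.
  have -> : (k + 1) * p * (1 - K * t) * (1 - K * (k * h + h)) =
    c * ((k + 1) * (1 - K * (k * h + h))) by rewrite /c; ring.
  have -> : c + k * p * (1 - K * t) * (1 - K * (k * h)) * (1 - K * h) =
    c * (1 + k * ((1 - K * (k * h)) * (1 - K * h))) by rewrite /c; ring.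
  apply: ler_wpM2l => //.
  have e0 : 0 <= K * (k * h) * (K * h) by rewrite !mulr_ge0// ltW.
  have e1 : 0 <= K * (k * h + h) by rewrite mulr_ge0// addr_ge0// ltW.
  have := mulr_ge0 k0 e0 => *; lra.
apply: lerD; first by rewrite ler_wpM2r.
apply: (@le_trans _ _ (a * (1 - K * h))); first by rewrite ler_wpM2r// subr_ge0.
by rewrite ler_wpM2l.
Qed.

(** A bound uniform in [x] and [y], although the derivative at 0 is only known
    for each pair separately: let the mesh of [mass_jump_iter] tend to 0. *)
Lemma mass_jump_ge t x y : 0 <= t -> K * t <= 1 -> x != y ->
  t * q x y * (1 - K * t) ^+ 2 <= mass (P t x) y.
Proof.
rewrite le_eqVlt => /predU1P[<- _ _|t0 Kt xy].
  by rewrite !mul0r mass_ge0.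
apply/ler_addgt0Pr => e e0; have K0 := rate_bound_ge0.
case: Pq => _ _ /(_ x y)/at_right_near/(_ (e / t) (divr_gt0 e0 t0))[h0 h00 H].
have [n] := exists_fraction_lt (ltW t0) h00; set h := t / n.+1%:R => hh0.
have hp : 0 < h by rewrite divr_gt0.
have nht : n.+1%:R * h = t by rewrite mulrC divfK.
have := H h; rewrite hp hh0 => /(_ isT).
rewrite (negbTE xy) mul0r !subr0 ltr_norml => /andP[+ _].
rewrite ltrBrDr ltr_pdivlMr//.
have := mass_jump_iter xy hp Kt nht (leqnn _).
rewrite nht; set p := mass (P h x) y; set a := mass _ _; set k := n.+1%:R in nht *.
move=> ap ph; apply: (@le_trans _ _ (k * p * (1 - K * t) * (1 - K * t) + e)); last first.
  by rewrite lerD2r.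
have c1 : (1 - K * t) ^+ 2 <= 1.
  by rewrite exprn_ile1 ?subr_ge0// lerBlDr lerDl mulr_ge0// ltW.
have c0 : 0 <= (1 - K * t) ^+ 2 by exact: sqr_ge0.
have kp : t * q x y - e <= k * p.
  have -> : t * q x y - e = k * ((- (e / t) + q x y) * h).
    by rewrite mulrCA nht; field; rewrite gt_eqF.
  by rewrite ler_wpM2l// ltW.
rewrite -[_ * _ * (1 - K * t)]mulrA -expr2.
move: (_ ^+ 2) c1 c0 kp => c c1 c0 kp.
apply: (@le_trans _ _ ((k * p + e) * c)); first by rewrite ler_wpM2r// -lerBlDr.
by rewrite mulrDl lerD2l ler_piMr// ltW.
Qed.

End transition.

(** * Balance of flows and invariance *)

Definition balanced (R : realType) (q : state -> state -> R) (w : state -> R) :=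
  forall y, inflow q w y = exit q y * w y.

Definition invariant (R : realType) (P : R -> state -> probability state R)
    (pi : probability state R) :=
  forall t (A : set state), 0 <= t ->
    mean pi (fun x => fine (P t x A)) = fine (pi A).

Lemma mean_transition_setC (R : realType) (P : R -> state -> probability state R)
    (pi : probability state R) t (A : set state) :
  mean pi (fun x => fine (P t x (~` A))) =
  1 - mean pi (fun x => fine (P t x A)).
Proof.
under [X in mean _ X]eq_fun do rewrite fine_setC.
by rewrite meanB ?mean_cst//; [exact: bdd_cst|exact: bdd_prob].
Qed.

Section flow.
Context {R : realType}.
Variables (q : state -> state -> R) (K : R).
Hypothesis qK : local_rates q K.
Implicit Types (w : state -> R) (x y z : state).

Let q0 x y : 0 <= q x y. Proof. by case: qK. Qed.
Let qd x : q x x = 0. Proof. by case: qK. Qed.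
Let qn x y : q x y != 0 -> y \in nbhd x /\ x \in nbhd y.
Proof. by case: qK => _ _ + _; exact. Qed.
Let exitK x : exit q x <= K. Proof. by case: qK. Qed.

Lemma box_mono m n : (m <= n)%N -> {subset box m <= box n}.
Proof.
by move=> mn x; rewrite !mem_box => /andP[a b]; rewrite !(leq_trans _ mn).
Qed.

Lemma nbhd_box x N : x \in box N -> {subset nbhd x <= box N.+1}.
Proof.
rewrite mem_box => /andP[a b]; apply: box_mono.
by rewrite ltnS -maxnSS geq_max a b.
Qed.

Lemma sum_nbhd (F : state -> R) (B : seq state) x : uniq B ->
  {subset nbhd x <= B} -> (forall y, y \notin nbhd x -> F y = 0) ->
  \sum_(y <- B) F y = \sum_(y <- nbhd x) F y.
Proof.
move=> uB xB F0; rewrite (bigID (mem (nbhd x)))/= [X in _ + X]big1 ?addr0//.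
rewrite -big_filter; apply: perm_big; apply: uniq_perm.
- exact: filter_uniq.
- exact: nbhd_uniq.
- by move=> y; rewrite mem_filter; case: (boolP (y \in nbhd x)) => //= /xB.
Qed.

(** The truncation of the inflow to [nbhd y] loses nothing, as no other state
    jumps to [y]. *)
Lemma sum_le_inflow w y (B : seq state) : (forall x, 0 <= w x) -> uniq B ->
  \sum_(x <- B) w x * q x y <= inflow q w y.
Proof.
move=> w0 uB.
have wq0 x : 0 <= w x * q x y by rewrite mulr_ge0.
rewrite (bigID (mem (nbhd y)))/= [X in _ + X]big1 ?addr0.
  rewrite -big_filter; apply: le_sum_subset => //.
  - exact: filter_uniq.
  - exact: nbhd_uniq.
  - by move=> x; rewrite mem_filter => /andP[].
move=> x xy; have [->|/qn[_]] := eqVneq (q x y) 0; first by rewrite mulr0.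
by rewrite (negbTE xy).
Qed.

(** Jumps from a box land in the next larger box. *)
Lemma outflow_le_inflow w N : (forall x, 0 <= w x) ->
  \sum_(x <- box N) exit q x * w x <= \sum_(y <- box N.+1) inflow q w y.
Proof.
move=> w0; apply: (@le_trans _ _
    (\sum_(y <- box N.+1) \sum_(x <- box N) w x * q x y)); last first.
  by apply: ler_sum => y _; apply: sum_le_inflow => //; exact: box_uniq.
rewrite exchange_big/= big_seq [leRHS]big_seq.
apply: ler_sum => x xN; rewrite -mulr_sumr mulrC.
rewrite (@sum_nbhd _ _ x) ?box_uniq//; first exact: nbhd_box.
by move=> y; apply: contraNeq => /qn[].
Qed.

(** Conservation of mass. The defect of the balance equation, summed over a
    box, is at most [K] times the weight of the boundary layer of the box. The
    layers have finite total weight, so summing over [n] boxes bounds [n]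
    times the defect at a given state by a constant. *)
Lemma subbalanced_balanced w (M : R) : (forall x, 0 <= w x) ->
  (forall N, \sum_(x <- box N) w x <= M) ->
  (forall y, inflow q w y <= exit q y * w y) -> balanced q w.
Proof.
move=> w0 wM sub y0; apply/eqP; rewrite eq_le sub/= -subr_le0.
pose d y := exit q y * w y - inflow q w y.
have d0 y : 0 <= d y by rewrite subr_ge0.
pose S N := \sum_(x <- box N) w x.
have step N : \sum_(y <- box N.+1) d y <= K * (S N.+1 - S N).
  have E : \sum_(x <- box N) (K - exit q x) * w x <=
           \sum_(x <- box N.+1) (K - exit q x) * w x.
    apply: le_sum_subset; rewrite ?box_uniq//; first exact: box_mono.
    by move=> x; rewrite mulr_ge0// subr_ge0.
  have EN n : \sum_(x <- box n) (K - exit q x) * w x =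
      K * S n - \sum_(x <- box n) exit q x * w x.
    by rewrite mulr_sumr -sumrB; apply: eq_bigr => x _; rewrite mulrBl.
  have := outflow_le_inflow N w0.
  move: E; rewrite !EN sumrB; set a := \sum_(x <- box N) _.
  set b := \sum_(x <- box _) _; set c := \sum_(x <- box _) _ => *; lra.
pose N0 := (maxn y0.1 y0.2).+1.
have y0N n : (N0 <= n)%N -> d y0 <= \sum_(y <- box n) d y.
  move=> n0; apply: sum_ge_term => //; first exact: box_uniq.
  by rewrite mem_box !(leq_trans _ n0)// ltnS ?leq_maxl ?leq_maxr.
have tele n : n%:R * d y0 <= K * (S (N0 + n)%N - S N0).
  elim: n => [|n ih]; first by rewrite addn0 subrr mulr0 mul0r.
  rewrite -natr1 mulrDl mul1r addnS.
  have := step (N0 + n)%N.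
  have := y0N (N0 + n).+1 (leqW (leq_addr _ _)).
  move: ih; set u := \sum_(y <- _) _ => *; lra.
rewrite leNgt; apply/negP => dy.
have S0 : 0 <= S N0 by apply: sumr_ge0.
have K0 : 0 <= K by exact: (rate_bound_ge0 qK).
have tele2 n : n%:R * d y0 <= K * M.
  by rewrite (le_trans (tele n))// ler_wpM2l// lerBlDr (le_trans (wM _))// lerDl.
have := tele2 (Num.truncn (K * M / d y0)).+1.
by rewrite leNgt -ltr_pdivrMr// truncnS_gt.
Qed.

Variable P : R -> state -> probability state R.
Hypothesis Pq : transition_function q P.

Lemma mass_ge h x y : 0 <= h -> K * h <= 1 ->
  (x == y)%:R * (1 - exit q y * h) + h * (1 - K * h) ^+ 2 * q x y <=
  mass (P h x) y.
Proof.
move=> h0 Kh; have [<-|xy] := eqVneq x y.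
  by rewrite qd mulr0 addr0 mul1r (mass_stay_ge qK Pq).
by rewrite mul0r add0r mulrAC (mass_jump_ge qK Pq).
Qed.

(** First order lower bound, with a quadratic error, of the mass that [w P_h]
    puts on [y]. *)
Lemma sum_flow_ge w h y : (forall x, 0 <= w x) -> 0 <= h -> K * h <= 1 ->
  w y * (1 - exit q y * h) + h * (1 - K * h) ^+ 2 * inflow q w y <=
  \sum_(x <- nbhd y) w x * mass (P h x) y.
Proof.
move=> w0 h0 Kh.
have -> : w y * (1 - exit q y * h) =
    \sum_(x <- nbhd y) w x * ((x == y)%:R * (1 - exit q y * h)).
  rewrite (bigD1_seq y) ?nbhd_refl ?nbhd_uniq//= eqxx mul1r big1 ?addr0//.
  by move=> x /negbTE ->; rewrite mul0r mulr0.
rewrite mulr_sumr -big_split/=; apply: ler_sum => x _.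
rewrite [_ * (w x * _)]mulrCA -mulrDr ler_wpM2l//; exact: mass_ge.
Qed.

Lemma sqr_defect h : 0 <= h -> 1 - 2 * K * h <= (1 - K * h) ^+ 2.
Proof. by move=> h0; have := sqr_ge0 (K * h); rewrite !expr2 => *; nra. Qed.

(** Invariance and [sum_flow_ge] bound the inflow by the outflow up to a factor
    that tends to 1 with [h]; conservation of mass gives equality. *)
Lemma invariant_balanced pi : invariant P pi -> balanced q (mass pi).
Proof.
move=> ipi; have K0 := rate_bound_ge0 qK.
have m0 := mass_ge0 pi.
have mM N : \sum_(x <- box N) mass pi x <= 1.
  rewrite -(mean_cst pi 1); under eq_bigr do rewrite -[mass _ _]mulr1.
  by apply: sum_le_mean; rewrite ?box_uniq//; exact: bdd_cst.
apply: subbalanced_balanced mM _ => // y.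
have sub h : 0 < h -> K * h <= 1 ->
    (1 - K * h) ^+ 2 * inflow q (mass pi) y <= exit q y * mass pi y.
  move=> h0 Kh; have := sum_flow_ge y m0 (ltW h0) Kh.
  have : \sum_(x <- nbhd y) mass pi x * mass (P h x) y <= mass pi y.
    rewrite -[leRHS](ipi h [set y] (ltW h0)).
    apply: sum_le_mean; rewrite ?nbhd_uniq//; first exact: bdd_prob.
    by move=> x; exact: mass_ge0.
  move: (\sum_(_ <- _) _) => S S1 S2.
  rewrite -(ler_pM2l h0); nra.
have in0 : 0 <= inflow q (mass pi) y by apply: sumr_ge0 => x _; rewrite mulr_ge0.
apply/ler_addgt0Pr => e e0.
(* the bound [e / c] makes the error 2 K h inflow at most [e], the other
   bound gives [K h <= 1] *)
pose c := 1 + 2 * K * inflow q (mass pi) y.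
have c0 : 0 < c by rewrite ltr_pwDl// !mulr_ge0.
pose h := Num.min (e / c) (1 + K)^-1.
have K1 : 0 < 1 + K by rewrite ltr_pwDl.
have h0 : 0 < h by rewrite lt_min invr_gt0 K1 divr_gt0.
have hc : c * h <= e by rewrite mulrC -ler_pdivlMr// ge_min lexx.
have hK : K * h <= 1.
  have : h <= (1 + K)^-1 by rewrite ge_min lexx orbT.
  rewrite -[leRHS]mul1r ler_pdivlMr// => ?; nra.
have := sub _ h0 hK; have := sqr_defect (ltW h0).
move: hc; rewrite /c; move: (_ ^+ 2) in0 => d.
move: (inflow _ _ _) => I I0 hc dh dI.
have : (1 - 2 * K * h) * I <= d * I by rewrite ler_wpM2r.
lra.
Qed.

Section balanced_invariant.
Variable pi : probability state R.
Hypothesis bpi : balanced q (mass pi).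

(** For a balanced weight the first order terms of [sum_flow_ge] cancel and
    only the quadratic error is left. *)
Lemma mean_step_ge h g : 0 <= h -> K * h <= 1 / 2 -> bdd g ->
  (forall x, 0 <= g x) ->
  (1 - 2 * K ^+ 2 * h ^+ 2) * mean pi g <= mean pi (fun x => mean (P h x) g).
Proof.
move=> h0 Kh bg g0; have K0 := rate_bound_ge0 qK.
have Kh0 : 0 <= K * h by rewrite mulr_ge0.
have c0 : 0 <= 1 - 2 * K ^+ 2 * h ^+ 2.
  by rewrite -mulrA -exprMn expr2; nra.
set c := 1 - _ in c0 *.
rewrite -meanZ//; apply: mean_le_box => [|x|N].
- by apply: bddM => //; exact: bdd_cst.
- by rewrite mulr_ge0.
apply: (@le_trans _ _ (\sum_(x <- box N.+1) mass pi x * mean (P h x) g)); last first.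
  apply: sum_le_mean; rewrite ?box_uniq//; first exact: bdd_mean.
  by move=> x; exact: mean_ge0.
apply: (@le_trans _ _ (\sum_(x <- box N.+1) mass pi x *
    \sum_(z <- box N) mass (P h x) z * g z)); last first.
  apply: ler_sum => x _; rewrite ler_wpM2l ?mass_ge0//.
  by apply: sum_le_mean; rewrite ?box_uniq.
under [leRHS]eq_bigr do rewrite mulr_sumr.
rewrite exchange_big/= big_seq [leRHS]big_seq; apply: ler_sum => z zN.
under eq_bigr do rewrite mulrA.
rewrite -mulr_suml mulrA ler_wpM2r//.
apply: (@le_trans _ _ (\sum_(x <- nbhd z) mass pi x * mass (P h x) z)); last first.
  apply: le_sum_subset; rewrite ?nbhd_uniq ?box_uniq//; first exact: nbhd_box.
  by move=> x; rewrite mulr_ge0// mass_ge0.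
have Kh1 : K * h <= 1 by lra.
have := sum_flow_ge z (mass_ge0 pi) h0 Kh1; apply: le_trans.
rewrite bpi /c.
have := exitK z; have := exit_ge0 qK z; have := sqr_defect h0.
have : 0 <= mass pi z by exact: mass_ge0.
move: ((1 - K * h) ^+ 2) (mass pi z) (exit q z) => d m ex m0 dK e0 eK.
have -> : m * (1 - ex * h) + h * d * (ex * m) = m * (1 - ex * h * (1 - d)) by ring.
rewrite ler_wpM2l// lerB//.
apply: (@le_trans _ _ (K * h * (2 * K * h))); last by rewrite !expr2 !mulrA; lra.
apply: (@le_trans _ _ (ex * h * (2 * K * h))).
  by rewrite ler_wpM2l ?mulr_ge0//; lra.
by rewrite !ler_wpM2r// !mulr_ge0.
Qed.

Lemma transition_start x (A : set state) : \1_A x <= fine (P 0 x A).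
Proof.
rewrite indicE; case: (boolP (x \in A)) => [|_]; last by rewrite fine_ge0.
rewrite inE => Ax; case: Pq => /(_ x) P0 _ _.
rewrite mulr1n -P0 -lee_fin /mass !EFin_prob; apply: le_measure.
- by apply: mem_set; exact: measurable_state.
- by apply: mem_set; exact: measurable_state.
- by move=> _ /= ->.
Qed.

(** The relative loss of one step, [2 K^2 h^2], is added up [m] times. *)
Lemma mean_iter_ge h m (A : set state) : 0 <= h -> K * h <= 1 / 2 ->
  (1 - m%:R * (2 * K ^+ 2 * h ^+ 2)) * fine (pi A) <=
  mean pi (fun x => fine (P (m%:R * h) x A)).
Proof.
move=> h0 Kh; elim: m => [|m ih].
  rewrite !mul0r subr0 mul1r -mean_indic; apply: le_mean => //.
  - by apply: bdd01 => x; rewrite indicE; case: (_ \in _); rewrite !lexx ler01.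
  - exact: bdd_prob.
  - by move=> x; exact: transition_start.
have mh : 0 <= m%:R * h by rewrite mulr_ge0.
have -> : (fun x => fine (P (m.+1%:R * h) x A)) =
    (fun x => mean (P h x) (fun z => fine (P (m%:R * h) z A))).
  apply/funext => x; rewrite -natr1 mulrDl mul1r addrC.
  exact: (chapman_kolmogorov Pq).
have := mean_step_ge h0 Kh (bdd_prob P (m%:R * h) A) (fun x => fine_ge0 (measure_ge0 _ _)).
apply: le_trans.
have K0 := rate_bound_ge0 qK.
have Kh0 : 0 <= K * h by rewrite mulr_ge0.
move: ih; set e := 2 * _ * _; set a := mean _ _ => ih.
have e01 : 0 <= e <= 1.
  by rewrite /e -mulrA -exprMn expr2; apply/andP; split; nra.
case/andP: e01 => e0 e1.
case/andP: (prob01 pi A) => p0 _.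
apply: (@le_trans _ _ ((1 - e) * ((1 - m%:R * e) * fine (pi A)))); last first.
  by rewrite ler_wpM2l// subr_ge0.
rewrite mulrA ler_wpM2r// -natr1.
have : 0 <= m%:R * e * e by rewrite !mulr_ge0.
lra.
Qed.

(** With steps of length [t / n] the total loss is of order [1 / n]. A lower
    bound for every event is an equality, by passing to complements. *)
Lemma balanced_invariant : invariant P pi.
Proof.
move=> t A t0.
have ge_ (B : set state) : fine (pi B) <= mean pi (fun x => fine (P t x B)).
  have K0 := rate_bound_ge0 qK.
  apply/ler_addgt0Pr => e e0.
  pose c := K ^+ 2 * t ^+ 2 * 2.
  have c0 : 0 <= c by rewrite !mulr_ge0 ?sqr_ge0.
  have d0 : 0 < Num.min e (1 / 2) by rewrite lt_min e0; lra.
  have [n] := exists_fraction_lt (addr_ge0 c0 (mulr_ge0 K0 t0)) d0.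
  rewrite lt_min mulrDl => /andP[ce cK].
  have n0 : 0 < n.+1%:R :> R by [].
  have Kt0 : 0 <= K * t / n.+1%:R by rewrite divr_ge0// mulr_ge0.
  have cn0 : 0 <= c / n.+1%:R by rewrite divr_ge0.
  have hK : K * (t / n.+1%:R) <= 1 / 2.
    by rewrite mulrA (le_trans _ (ltW cK))// lerDr.
  have := mean_iter_ge n.+1 B (divr_ge0 t0 (ltW n0)) hK.
  rewrite [n.+1%:R * (t / _)]mulrC divfK ?gt_eqF//.
  have -> : n.+1%:R * (2 * K ^+ 2 * (t / n.+1%:R) ^+ 2) = c / n.+1%:R.
    by rewrite /c; move: (n.+1%:R) n0 => k k0; field; rewrite gt_eqF.
  case/andP: (prob01 pi B) => p0 p1.
  move: (mean _ _) => a.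
  have : c / n.+1%:R <= e by rewrite (le_trans _ (ltW ce))// lerDl.
  move: (c / _) cn0 => u u0 ue H; nra.
apply/eqP; rewrite eq_le ge_ andbT -lerN2 -(lerD2l 1).
by rewrite -mean_transition_setC -fine_setC.
Qed.

End balanced_invariant.
End flow.

(** * Uniqueness of balanced weights; exponential limits are invariant *)

(** Reachability of [o], in the form of the induction principle that it is
    used for: a property of [o] that passes backward along jumps holds
    everywhere. *)
Definition leads_to (R : realType) (q : state -> state -> R) (o : state) :=
  forall Z : state -> Prop, Z o ->
    (forall x y, q x y != 0 -> Z y -> Z x) -> forall x, Z x.

Section uniqueness.
Context {R : realType}.
Variables (q : state -> state -> R) (K : R) (o : state).
Hypotheses (qK : local_rates q K) (qo : leads_to q o).
Implicit Types (u v w : state -> R).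

Let q0 x y : 0 <= q x y. Proof. by case: qK. Qed.

Lemma balancedZ c w : balanced q w -> balanced q (fun x => c * w x).
Proof.
move=> bw y; rewrite mulrCA -bw mulr_sumr.
by apply: eq_bigr => x _; rewrite mulrA.
Qed.

Lemma balancedB u v : balanced q u -> balanced q v ->
  balanced q (fun x => u x - v x).
Proof.
move=> bu bv y; rewrite mulrBr -bu -bv -sumrB.
by apply: eq_bigr => x _; rewrite mulrBl.
Qed.

(** If nothing sits at [y] then nothing flows into [y], so nothing sits at the
    states that jump to [y]. *)
Lemma balanced_eq0 w : (forall x, 0 <= w x) -> balanced q w -> w o = 0 ->
  forall x, w x = 0.
Proof.
move=> w0 bw wo; apply: qo => // x y qxy wy.
have := sum_le_inflow qK y w0 (isT : uniq [:: x]).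
rewrite big_seq1 bw wy mulr0 => H.
have : w x * q x y == 0 by rewrite eq_le H mulr_ge0.
by rewrite mulf_eq0 (negbTE qxy) orbF => /eqP.
Qed.

Lemma balanced_mass_gt0 (pi : probability state R) :
  balanced q (mass pi) -> 0 < mass pi o.
Proof.
move=> bpi; rewrite lt_neqAle mass_ge0 andbT; apply/eqP => pi0.
have pi_eq0 := balanced_eq0 (mass_ge0 pi) bpi (esym pi0).
suff : mean pi (fun=> 1) <= 0 by rewrite mean_cst ler10.
apply: mean_le_box => // [|N]; first exact: bdd_cst.
by rewrite big1// => x _; rewrite pi_eq0 mul0r.
Qed.

(** The minimum of the two balanced weights [v] and [c * u] receives at most
    what it sends and has finite mass, hence is balanced. With
    [c = v o / u o], the differences between the two weights and their minimum
    are balanced, nonnegative and zero at [o]. The weight [v] may have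
    infinite mass; this is what rules out an invariant probability when the
    explicit weight is not summable. *)
Lemma balanced_unique u v (M : R) : (forall x, 0 <= u x) ->
  (forall x, 0 <= v x) -> (forall N, \sum_(x <- box N) u x <= M) ->
  0 < u o -> balanced q u -> balanced q v ->
  forall x, v x = v o / u o * u x.
Proof.
move=> u0 v0 uM uo bu bv; set c := v o / u o.
have c0 : 0 <= c by rewrite divr_ge0// ltW.
pose m x := Num.min (v x) (c * u x).
have m0 x : 0 <= m x by rewrite le_min v0 mulr_ge0.
have bm : balanced q m.
  apply: (@subbalanced_balanced _ _ _ qK _ (c * M)) => // [N|y].
    rewrite (le_trans _ (ler_wpM2l c0 (uM N)))// mulr_sumr.
    by apply: ler_sum => x _; rewrite ge_min lexx orbT.
  rewrite {2}/m; case: (leP (v y) (c * u y)) => _.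
    rewrite -bv; apply: ler_sum => x _.
    by rewrite ler_wpM2r// ge_min lexx.
  rewrite -(balancedZ c bu); apply: ler_sum => x _.
  by rewrite ler_wpM2r// ge_min lexx orbT.
have co : c * u o = v o by rewrite divfK// gt_eqF.
have cm x : c * u x - m x = 0.
  apply: (balanced_eq0 _ (balancedB (balancedZ c bu) bm)) => [y|].
    by rewrite subr_ge0 ge_min lexx orbT.
  by rewrite /m co minxx subrr.
have vc x : c * u x <= v x.
  by move/eqP: (cm x); rewrite subr_eq0 => /eqP ->; rewrite ge_min lexx.
move=> x; apply/eqP; rewrite -subr_eq0; apply/eqP.
apply: (balanced_eq0 _ (balancedB bv (balancedZ c bu))) => [y|].
  by rewrite subr_ge0.
by rewrite co subrr.
Qed.

End uniqueness.

Lemma geometric_small (R : realType) (rho c e : R) : 0 <= rho < 1 -> 0 < e ->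
  exists n : nat, c * rho ^+ n.+1 < e.
Proof.
move=> /andP[r0 r1] e0.
have /cvgrPdist_lt/(_ (e / (`|c| + 1))) : rho ^+ n @[n --> \oo] --> 0.
  by apply: cvg_expr; rewrite ger0_norm.
have c1 : 0 < `|c| + 1 by rewrite ltr_wpDl.
move=> /(_ (divr_gt0 e0 c1))[N _ /(_ N.+1 (leqnSn N))].
rewrite /= sub0r normrN ger0_norm ?exprn_ge0// ltr_pdivlMr// => H.
exists N; apply: le_lt_trans H; rewrite mulrC ler_wpM2l ?exprn_ge0//.
by rewrite (le_trans (ler_norm _))// lerDl.
Qed.

Definition exponential_rate (R : realType) (P : R -> state -> probability state R)
    (pi : probability state R) (rho : R) :=
  forall x, exists C : R, forall t, 0 < t -> forall A : set state,
    `|fine (P t x A) - fine (pi A)| <= C * rho `^ t.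

Section exponential_limits.
Context {R : realType}.
Variables (q : state -> state -> R).
Variable P : R -> state -> probability state R.
Hypotheses (Pq : transition_function q P).

Lemma powR_le_geometric (rho t : R) n : 0 <= rho < 1 -> n.+1%:R <= t ->
  rho `^ t <= rho ^+ n.+1.
Proof.
move=> /andP[]; rewrite le_eqVlt => /predU1P[<- _|r0 r1] nt.
  by rewrite powR0 ?exprn_ge0// gt_eqF// (lt_le_trans _ nt).
by rewrite -powR_mulrn ?(ltW r0)//; apply: ger_powR => //; rewrite r0 ltW.
Qed.

Lemma exponential_rate_near pi rho : 0 <= rho < 1 ->
  exponential_rate P pi rho -> forall x e, 0 < e ->
  exists n : nat, forall t A, n.+1%:R <= t ->
    `|fine (P t x A) - fine (pi A)| < e.
Proof.
move=> r01 rate x e e0; have [C HC] := rate x.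
have [n Hn] := geometric_small `|C| r01 e0.
exists n => t A nt; apply: le_lt_trans (HC t _ A) _.
  exact: lt_le_trans nt.
apply: le_lt_trans Hn; apply: (@le_trans _ _ (`|C| * rho `^ t)).
  by rewrite ler_wpM2r ?powR_ge0// ler_norm.
by rewrite ler_wpM2l// powR_le_geometric.
Qed.

Lemma exponential_rate_unique pi pi' rho rho' :
  0 <= rho < 1 -> 0 <= rho' < 1 ->
  exponential_rate P pi rho -> exponential_rate P pi' rho' ->
  forall A : set state, fine (pi' A) = fine (pi A).
Proof.
move=> r01 r01' rate rate' A; apply/eqP; rewrite -subr_eq0 -normr_le0.
apply/ler_addgt0Pr => e e0; rewrite add0r.
have e2 : 0 < e / 2 by rewrite divr_gt0.
have [n Hn] := exponential_rate_near r01 rate (0, 0)%N e2.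
have [m Hm] := exponential_rate_near r01' rate' (0, 0)%N e2.
have := Hn (n.+1%:R + m.+1%:R) A; have := Hm (n.+1%:R + m.+1%:R) A.
rewrite lerDl lerDr !ler0n !ltr_norml => /(_ isT)/andP[a1 a2] /(_ isT)/andP[b1 b2].
rewrite ler_norml; apply/andP; split; lra.
Qed.

(** Chapman-Kolmogorov restricted to a box passes to the limit in the first
    time, which gives [pi P_t <= pi] on all events, hence equality by passing
    to complements. *)
Lemma exponential_rate_invariant pi rho : 0 <= rho < 1 ->
  exponential_rate P pi rho -> invariant P pi.
Proof.
move=> r01 rate t A t0.
have le_ (B : set state) : mean pi (fun x => fine (P t x B)) <= fine (pi B).
  apply: mean_le_box => [|x|N]; [exact: bdd_prob|by rewrite fine_ge0|].
  apply/ler_addgt0Pr => e e0.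
  have d0 : 0 < e / (size (box N)).+1%:R by rewrite divr_gt0.
  have [n Hn] := exponential_rate_near r01 rate (0, 0)%N d0.
  set d := e / _ in d0 Hn.
  have n0 : 0 <= n.+1%:R :> R by [].
  have := chapman_kolmogorov_ge Pq (0, 0)%N B n0 t0 (box_uniq N).
  have := Hn (n.+1%:R + t) B; rewrite lerDl t0 ltr_norml => /(_ isT)/andP[_].
  set b := fine (P _ _ B) => bd Sb.
  apply: (@le_trans _ _ (\sum_(x <- box N)
      (mass (P n.+1%:R (0, 0)%N) x * fine (P t x B) + d))).
    apply: ler_sum => x _.
    have := Hn n.+1%:R [set x]; rewrite lexx ltr_norml => /(_ isT)/andP[+ _].
    rewrite -/(mass _ _) -/(mass _ _) => H.
    case/andP: (prob01 (P t x) B) => p0 p1.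
    move: H p0 p1; move: (mass _ _) (mass _ _) (fine _) => m1 m2 p *; nra.
  rewrite big_split/= big_const_seq count_predT iter_addr_0.
  have -> : e = d *+ (size (box N)) + d by rewrite -mulrSr -mulr_natr divfK.
  lra.
apply/eqP; rewrite eq_le le_/= -lerN2 -(lerD2l 1).
by rewrite -mean_transition_setC -fine_setC.
Qed.

End exponential_limits.

(** * A Poincare inequality for geometric weights and L2 contraction *)

Section poincare.
Context {R : realType}.
Implicit Types (r s : R) (f : state -> R).

(** Since [u 0 = 0], shifting the index shows that the left-hand sum [S] is at
    most [s] times the sum of [s ^+ a * u a.+1 ^+ 2]; writing [u a.+1] as [u a]
    plus an increment and absorbing the cross term yields
    [S <= (1 + s) / 2 * S + 3 / (1 - s) * T]. *)
Lemma geometric_hardy s (u : nat -> R) N : 0 <= s < 1 -> u 0%N = 0 ->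
  \sum_(0 <= a < N) s ^+ a * u a ^+ 2 <=
  6 / (1 - s) ^+ 2 * \sum_(0 <= a < N) s ^+ a * (u a.+1 - u a) ^+ 2.
Proof.
move=> /andP[s0 s1] u0.
set S := \sum_(_ <= _ < _) _; set T := \sum_(_ <= _ < _) _.
have s10 : 0 < 1 - s by rewrite subr_gt0.
have step : S <= (1 + s) / 2 * S + 3 / (1 - s) * T.
  apply: (@le_trans _ _ (\sum_(0 <= a < N.+1) s ^+ a * u a ^+ 2)).
    by rewrite big_nat_recr//= lerDl mulr_ge0 ?sqr_ge0 ?exprn_ge0.
  rewrite big_nat_recl//= u0 expr0n mulr0 add0r /S /T !mulr_sumr -big_split/=.
  apply: ler_sum => a _; rewrite exprS.
  have sa0 : 0 <= s ^+ a by rewrite exprn_ge0.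
  have -> : (1 + s) / 2 * (s ^+ a * u a ^+ 2) +
      3 / (1 - s) * (s ^+ a * (u a.+1 - u a) ^+ 2) =
      s ^+ a * ((1 + s) / 2 * u a ^+ 2 + 3 / (1 - s) * (u a.+1 - u a) ^+ 2).
    by ring.
  rewrite -mulrA mulrCA ler_wpM2l//.
  have [d ->] : exists d, u a.+1 = u a + d by exists (u a.+1 - u a); ring.
  rewrite addrAC subrr add0r; move: (u a) => v.
  rewrite -(ler_pM2l s10).
  have -> : (1 - s) * ((1 + s) / 2 * v ^+ 2 + 3 / (1 - s) * d ^+ 2) =
      (1 - s) * ((1 + s) / 2) * v ^+ 2 + 3 * d ^+ 2.
    by field; rewrite gt_eqF.
  have s2 : s ^+ 2 <= 1 by rewrite exprn_ile1// ltW.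
  rewrite -subr_ge0.
  (* completing the square in v *)
  have -> : (1 - s) * ((1 + s) / 2) * v ^+ 2 + 3 * d ^+ 2 -
      (1 - s) * (s * (v + d) ^+ 2) =
      2 * ((1 - s) * v / 2 - s * d) ^+ 2 +
      ((1 - s) + (1 - s ^+ 2) + 1) * d ^+ 2 by field.
  have k0 : 0 <= (1 - s) + (1 - s ^+ 2) + 1 by lra.
  by rewrite addr_ge0// mulr_ge0// sqr_ge0.
have -> : 6 / (1 - s) ^+ 2 * T = (3 / (1 - s) * T) / ((1 - s) / 2).
  by field; rewrite gt_eqF.
by rewrite ler_pdivlMr; lra.
Qed.

Definition weight s r (x : state) : R := s ^+ x.1 * r ^+ x.2.

Definition grad2 f (x : state) : R :=
  (f (x.1.+1, x.2) - f x) ^+ 2 + (f (x.1, x.2.+1) - f x) ^+ 2.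

Lemma geometric_sum_le r N : 0 <= r < 1 ->
  \sum_(0 <= b < N) r ^+ b <= (1 - r)^-1.
Proof.
move=> /andP[r0 r1]; rewrite -[leRHS]mul1r ler_pdivlMr ?subr_gt0//.
rewrite mulrC -opprB mulNr big_mkord -subrX1 opprB lerBlDr lerDl.
exact: exprn_ge0.
Qed.

Definition hardy_const s r : R :=
  2 * (6 / (1 - r) ^+ 2) + 2 * ((1 - r)^-1 * (6 / (1 - s) ^+ 2)).

Lemma hardy_const_ge0 s r : 0 <= r < 1 -> 0 <= hardy_const s r.
Proof.
move=> /andP[_ r1]; have d0 u : 0 <= 6 / (1 - u) ^+ 2 :> R.
  by rewrite divr_ge0 ?sqr_ge0.
have i0 : 0 <= (1 - r)^-1 by rewrite invr_ge0 subr_ge0 ltW.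
by apply: addr_ge0; apply: mulr_ge0 => //; exact: mulr_ge0.
Qed.

(** The difference [f (a, b) - f (0, 0)] splits into a vertical part along the
    column [a] and a horizontal part along the axis [b = 0]; the
    one-dimensional inequality applies to each. *)
Lemma plane_hardy s r f N : 0 <= s < 1 -> 0 <= r < 1 ->
  \sum_(x <- box N) weight s r x * (f x - f (0, 0)%N) ^+ 2 <=
  hardy_const s r * \sum_(x <- box N) weight s r x * grad2 f x.
Proof.
move=> s01 r01; have /andP[s0 s1] := s01; have /andP[r0 r1] := r01.
pose V := \sum_(x <- box N) weight s r x * (f (x.1, x.2.+1) - f x) ^+ 2.
pose H := \sum_(x <- box N) weight s r x * (f (x.1.+1, x.2) - f x) ^+ 2.
have w0 x : 0 <= weight s r x by rewrite mulr_ge0 ?exprn_ge0.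
have V0 : 0 <= V by apply: sumr_ge0 => x _; rewrite mulr_ge0 ?sqr_ge0.
have H0 : 0 <= H by apply: sumr_ge0 => x _; rewrite mulr_ge0 ?sqr_ge0.
have -> : \sum_(x <- box N) weight s r x * grad2 f x = H + V.
  by rewrite -big_split/=; apply: eq_bigr => x _; rewrite mulrDr.
have leV : \sum_(x <- box N) weight s r x * (f x - f (x.1, 0%N)) ^+ 2 <=
    6 / (1 - r) ^+ 2 * V.
  rewrite /V !sum_box mulr_sumr; apply: ler_sum => a _.
  rewrite /weight /=.
  under eq_bigr do rewrite -mulrA; under [in leRHS]eq_bigr do rewrite -mulrA.
  rewrite -!mulr_sumr mulrCA ler_wpM2l ?exprn_ge0//.
  have := @geometric_hardy r (fun b => f (a, b) - f (a, 0%N)) N r01 (subrr _).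
  move/le_trans; apply; rewrite ler_wpM2l ?divr_ge0 ?sqr_ge0//.
  apply: ler_sum => b _.
  by rewrite opprB addrA subrK.
have leH : \sum_(x <- box N) weight s r x * (f (x.1, 0%N) - f (0, 0)%N) ^+ 2 <=
    (1 - r)^-1 * (6 / (1 - s) ^+ 2) * H.
  apply: (@le_trans _ _ ((1 - r)^-1 *
     \sum_(0 <= a < N) s ^+ a * (f (a, 0%N) - f (0, 0)%N) ^+ 2)).
    rewrite sum_box mulr_sumr; apply: ler_sum => a _; rewrite /weight /=.
    under eq_bigr do rewrite mulrAC.
    rewrite -mulr_sumr mulrC ler_wpM2r ?geometric_sum_le//.
    by rewrite mulr_ge0 ?sqr_ge0 ?exprn_ge0.
  rewrite -mulrA ler_wpM2l ?invr_ge0 ?subr_ge0 ?(ltW r1)//.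
  have := @geometric_hardy s (fun a => f (a, 0%N) - f (0, 0)%N) N s01 (subrr _).
  move/le_trans; apply; rewrite ler_wpM2l ?divr_ge0 ?sqr_ge0//.
  rewrite /H sum_box; apply: ler_sum_nat => a /andP[_ aN].
  rewrite opprB addrA subrK.
  rewrite (big_ltn (leq_ltn_trans (leq0n a) aN)) /weight/= mulr1.
  rewrite lerDl; apply: sumr_ge0 => b _.
  by apply: mulr_ge0; [exact: (w0 (a, b))|exact: sqr_ge0].
apply: (@le_trans _ _ (2 * (6 / (1 - r) ^+ 2 * V) +
    2 * ((1 - r)^-1 * (6 / (1 - s) ^+ 2) * H))).
  apply: le_trans (lerD (ler_wpM2l _ leV) (ler_wpM2l _ leH)) => //.
  rewrite !mulr_sumr -big_split/=; apply: ler_sum => x _.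
  have := w0 x; move: (weight s r x) (f x) (f (x.1, 0%N)) (f (0, 0)%N) => w a b c W.
  have -> : 2 * (w * (a - b) ^+ 2) + 2 * (w * (b - c) ^+ 2) =
    w * (2 * (a - b) ^+ 2 + 2 * (b - c) ^+ 2) by ring.
  rewrite ler_wpM2l// -subr_ge0.
  have -> : 2 * (a - b) ^+ 2 + 2 * (b - c) ^+ 2 - (a - c) ^+ 2 =
    ((a - b) - (b - c)) ^+ 2 by ring.
  exact: sqr_ge0.
rewrite /hardy_const mulrDl.
have k1 : 0 <= 6 / (1 - r) ^+ 2 by rewrite divr_ge0 ?sqr_ge0.
have k2 : 0 <= (1 - r)^-1 * (6 / (1 - s) ^+ 2).
  by rewrite mulr_ge0 ?divr_ge0 ?sqr_ge0// invr_ge0 subr_ge0 ltW.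
move: (6 / (1 - r) ^+ 2) (_ * (6 / _)) k1 k2 => k k' k0 k'0.
rewrite !mulrA !mulrDr.
have : 0 <= k * H by exact: mulr_ge0.
have : 0 <= k' * V by exact: mulr_ge0.
lra.
Qed.

Lemma bdd_shift f (g : state -> state) : bdd f -> bdd (fun x => f (g x)).
Proof. by move=> [M fM]; exists M => x. Qed.

Lemma bdd_grad2 f : bdd f -> bdd (grad2 f).
Proof.
by move=> bf; apply: bddD; apply: bdd_sqr; apply: bddB => //; exact: bdd_shift.
Qed.

Lemma grad2_ge0 f x : 0 <= grad2 f x.
Proof. by rewrite addr_ge0 ?sqr_ge0. Qed.

Lemma mean_sqrB (mu : probability state R) f (c : R) : bdd f ->
  mean mu (fun x => (f x - c) ^+ 2) =
  mean mu (fun x => f x ^+ 2) - 2 * c * mean mu f + c ^+ 2.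
Proof.
move=> bf; have bf2 := bdd_sqr bf; have b2 := bddM (bdd_cst (2 * c)) bf.
have bc := bdd_cst (c ^+ 2).
have -> : (fun x => (f x - c) ^+ 2) =
    (fun x => (f x ^+ 2 - (2 * c) * f x) + c ^+ 2).
  by apply/funext => x; ring.
rewrite (meanD _ (bddB bf2 b2) bc) (meanB _ bf2 b2) meanZ//.
by rewrite mean_cst.
Qed.

(** The variance is at most the mean square distance to any constant, here the
    value at the origin. *)
Lemma poincare s r (c1 c2 : R) (pi : probability state R) f :
  0 <= s < 1 -> 0 <= r < 1 -> 0 < c1 ->
  (forall x, c1 * weight s r x <= mass pi x <= c2 * weight s r x) ->
  bdd f -> mean pi f = 0 ->
  mean pi (fun x => f x ^+ 2) <=
  c2 / c1 * hardy_const s r * mean pi (grad2 f).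
Proof.
move=> s01 r01 c10 piW bf mf; set c := f (0, 0)%N.
have c20 : 0 <= c2.
  have /andP[+ _] := piW (0, 0)%N; have /andP[_] := piW (0, 0)%N.
  by rewrite /weight !mulr1 => ? ?; lra.
have bfc : bdd (fun x => f x - c) by apply: bddB => //; exact: bdd_cst.
have k0 : 0 <= hardy_const s r.
  exact: hardy_const_ge0.
apply: (@le_trans _ _ (mean pi (fun x => (f x - c) ^+ 2))).
  by rewrite mean_sqrB// mf mulr0 subr0 lerDl sqr_ge0.
apply: mean_le_box => [|x|N]; [exact: bdd_sqr|exact: sqr_ge0|].
apply: (@le_trans _ _ (c2 * \sum_(x <- box N) weight s r x * (f x - c) ^+ 2)).
  rewrite mulr_sumr; apply: ler_sum => x _.
  by rewrite mulrA ler_wpM2r ?sqr_ge0//; case/andP: (piW x).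
have := plane_hardy f N s01 r01; rewrite -/c => /(ler_wpM2l c20)/le_trans; apply.
rewrite [c2 / c1]mulrC -!mulrA ler_pdivlMl//.
rewrite mulrCA ler_wpM2l// mulrCA ler_wpM2l//.
apply: le_trans (sum_le_mean pi (box_uniq N) (bdd_grad2 bf) (grad2_ge0 f)).
rewrite mulr_sumr; apply: ler_sum => x _.
by rewrite mulrA ler_wpM2r ?grad2_ge0//; case/andP: (piW x).
Qed.

End poincare.

Section contraction.
Context {R : realType}.
Variable P : R -> state -> probability state R.
Variable pi : probability state R.
Hypothesis ipi : invariant P pi.
Implicit Types (f : state -> R).

Lemma mean_sum (mu : probability state R) (s : seq state)
    (F : state -> state -> R) : (forall z, bdd (F z)) ->
  mean mu (fun x => \sum_(z <- s) F z x) = \sum_(z <- s) mean mu (F z) /\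
  bdd (fun x => \sum_(z <- s) F z x).
Proof.
move=> bF; elim: s => [|z s [ih1 ih2]].
  under [X in mean _ X]eq_fun do rewrite big_nil.
  under [X in bdd X]eq_fun do rewrite big_nil.
  by rewrite mean_cst big_nil; split => //; exact: bdd_cst.
under [X in mean _ X]eq_fun do rewrite big_cons.
under [X in bdd X]eq_fun do rewrite big_cons.
by rewrite meanD// ih1 big_cons; split => //; exact: bddD.
Qed.

(** The reverse inequality for nonnegative functions follows from invariance
    on points by truncating to boxes; it is applied to [M - f]. *)
Lemma invariant_mean_le t f : 0 <= t -> bdd f ->
  mean pi (fun x => mean (P t x) f) <= mean pi f.
Proof.
move=> t0 [M fM].
suff ge_ g : (forall x, 0 <= g x) -> bdd g ->
    mean pi g <= mean pi (fun x => mean (P t x) g).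
  have bf : bdd f by exists M.
  have bM := bdd_cst M.
  have := ge_ (fun x => M - f x).
  have -> : (fun x => mean (P t x) (fun z => M - f z)) =
      (fun x => M - mean (P t x) f).
    by apply/funext => x; rewrite meanB// mean_cst.
  rewrite !meanB ?mean_cst//; last exact: bdd_mean.
  rewrite lerD2l lerN2; apply; last exact: bddB.
  by move=> x; rewrite subr_ge0 (le_trans (ler_norm _)).
move=> g0 bg; apply: mean_le_box => // N.
have bF z : bdd (fun x => g z * mass (P t x) z).
  by apply: bddM; [exact: bdd_cst|exact: bdd_prob].
have [ms bs] := mean_sum pi (box N) bF.
apply: (@le_trans _ _ (mean pi (fun x => \sum_(z <- box N) g z * mass (P t x) z))).
  rewrite ms; apply: ler_sum => z _; rewrite meanZ; last exact: bdd_prob.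
  by rewrite mulrC ler_wpM2l// ipi.
apply: le_mean => //; first exact: bdd_mean.
move=> x; under eq_bigr do rewrite mulrC.
by apply: sum_le_mean => //; exact: box_uniq.
Qed.

(** The variance of [f] under [mu] dominates the part carried by three points
    of mass at least [eps], whatever the mean of [f] is. *)
Lemma variance_ge (mu : probability state R) (eps : R) f x : bdd f ->
  0 <= eps -> eps <= mass mu x -> eps <= mass mu (x.1.+1, x.2) ->
  eps <= mass mu (x.1, x.2.+1) ->
  mean mu f ^+ 2 + eps / 4 * grad2 f x <= mean mu (fun z => f z ^+ 2).
Proof.
move=> bf e0 ex e1 e2; set c := mean mu f.
have bfc : bdd (fun x => (f x - c) ^+ 2).
  by apply: bdd_sqr; apply: bddB => //; exact: bdd_cst.
have E : mean mu (fun z => (f z - c) ^+ 2) = mean mu (fun z => f z ^+ 2) - c ^+ 2.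
  by rewrite mean_sqrB// -/c; ring.
rewrite addrC -lerBrDr -E.
have u3 : uniq [:: x; (x.1.+1, x.2); (x.1, x.2.+1)].
  by case: x {ex e1 e2} => a b; rewrite /= !inE !xpair_eqE; lia.
apply: le_trans (sum_le_mean mu u3 bfc (fun=> sqr_ge0 _)).
rewrite !big_cons big_nil addr0 /grad2.
set x1 := (x.1.+1, _) in e1 *; set x2 := (x.1, _) in e2 *.
apply: (@le_trans _ _ (eps * ((f x - c) ^+ 2 + ((f x1 - c) ^+ 2 + (f x2 - c) ^+ 2)))).
  rewrite -mulrA ler_wpM2l//.
  have := sqr_ge0 (f x1 - c + (f x - c)); have := sqr_ge0 (f x2 - c + (f x - c)).
  have := sqr_ge0 (f x1 - c); have := sqr_ge0 (f x2 - c).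
  rewrite !expr2 => *; nra.
by rewrite !mulrDr !lerD// ler_wpM2r ?sqr_ge0.
Qed.

(** The L2 norm lost by [P h] is the mean conditional variance, which is
    bounded below through [variance_ge] and the Poincare inequality. *)
Lemma contraction_step h (eps k : R) f : 0 <= h -> 0 < eps -> 0 < k ->
  (forall x, [/\ eps <= mass (P h x) x, eps <= mass (P h x) (x.1.+1, x.2)
    & eps <= mass (P h x) (x.1, x.2.+1)]) ->
  (forall g, bdd g -> mean pi g = 0 ->
     mean pi (fun x => g x ^+ 2) <= k * mean pi (grad2 g)) ->
  bdd f -> mean pi f = 0 ->
  mean pi (fun x => mean (P h x) f ^+ 2) <=
  (1 - eps / (4 * k)) * mean pi (fun x => f x ^+ 2).
Proof.
move=> h0 e0 k0 Ph poin bf mf.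
have bm := bdd_sqr (bdd_mean (P h) bf).
have bg := bddM (bdd_cst (eps / 4)) (bdd_grad2 bf).
have : mean pi (fun x => mean (P h x) f ^+ 2 + eps / 4 * grad2 f x) <=
       mean pi (fun x => f x ^+ 2).
  apply: le_trans (invariant_mean_le h0 (bdd_sqr bf)).
  apply: le_mean; [exact: bddD|exact/bdd_mean/bdd_sqr|move=> x].
  by have [? ? ?] := Ph x; apply: variance_ge => //; exact: ltW.
rewrite meanD// meanZ; last exact: bdd_grad2.
have := poin f bf mf; rewrite -ler_pdivrMl// => H.
rewrite mulrBl mul1r lerBrDr; apply: le_trans; rewrite lerD2l.
have -> : eps / (4 * k) * mean pi (fun x => f x ^+ 2) =
    eps / 4 * (k^-1 * mean pi (fun x => f x ^+ 2)).
  by field; rewrite gt_eqF.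
by rewrite ler_wpM2l// divr_ge0// ltW.
Qed.

End contraction.

(** * Exponential decay in total variation *)

Section decay.
Context {R : realType}.
Variables (q : state -> state -> R) (P : R -> state -> probability state R).
Variable pi : probability state R.
Hypotheses (Pq : transition_function q P) (ipi : invariant P pi).
Variables (h eps k : R).
Hypotheses (h0 : 0 < h) (e0 : 0 < eps) (k0 : 0 < k).
Hypothesis Ph : forall x, [/\ eps <= mass (P h x) x,
  eps <= mass (P h x) (x.1.+1, x.2) & eps <= mass (P h x) (x.1, x.2.+1)].
Hypothesis poin : forall g, bdd g -> mean pi g = 0 ->
  mean pi (fun x => g x ^+ 2) <= k * mean pi (grad2 g).

(** The maximum with [1 / 2] only ensures that the rate is positive, so that
    its real powers behave well. *)
Let theta := Num.max (1 - eps / (4 * k)) (1 / 2).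

Let theta01 : 0 < theta < 1.
Proof.
rewrite lt_max gt_max divr_gt0//= orbT gtrBl divr_gt0// ?mulr_gt0//=.
lra.
Qed.

(** The offset [s] lets one grid of mesh [h] reach every time. *)
Lemma l2_decay s (A : set state) n : 0 <= s ->
  mean pi (fun x => (fine (P (n%:R * h + s) x A) - fine (pi A)) ^+ 2) <=
  theta ^+ n.
Proof.
move=> s0; have [t0 t1] := andP theta01.
have bF m : bdd (fun x => fine (P (m%:R * h + s) x A) - fine (pi A)).
  by apply: bddB; [exact: bdd_prob|exact: bdd_cst].
elim: n => [|n ih].
  rewrite expr0 -[leRHS](mean_cst pi); apply: le_mean.
  - exact/bdd_sqr/bF.
  - exact: bdd_cst.
  - move=> x; case/andP: (prob01 (P (0%:R * h + s) x) A) => a0 a1.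
    case/andP: (prob01 pi A) => b0 b1.
    by rewrite -ler_sqrt// sqrtr1 sqrtr_sqr ler_norml; apply/andP; split; lra.
have mn0 : 0 <= n%:R * h + s by rewrite addr_ge0// mulr_ge0// ltW.
have FS x : fine (P (n.+1%:R * h + s) x A) - fine (pi A) =
    mean (P h x) (fun z => fine (P (n%:R * h + s) z A) - fine (pi A)).
  rewrite meanB ?mean_cst; [|exact: bdd_prob|exact: bdd_cst].
  rewrite -(chapman_kolmogorov Pq) ?(ltW h0)//.
  by rewrite -natr1 mulrDl mul1r addrAC addrC.
under [X in mean _ X]eq_fun do rewrite FS.
rewrite exprS (le_trans (contraction_step ipi (ltW h0) e0 k0 Ph poin (bF n) _))//.
  rewrite meanB ?mean_cst; [|exact: bdd_prob|exact: bdd_cst].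
  by rewrite ipi// subrr.
apply: (@le_trans _ _ (theta * mean pi (fun x =>
    (fine (P (n%:R * h + s) x A) - fine (pi A)) ^+ 2))).
  apply: ler_wpM2r; first by apply: mean_ge0 => x; exact: sqr_ge0.
  by rewrite le_max lexx.
by rewrite ler_wpM2l// ltW.
Qed.

Lemma exponential_decay : (forall x, 0 < mass pi x) ->
  exists2 rho, 0 <= rho < 1 & exponential_rate P pi rho.
Proof.
move=> pi0; have [t0 t1] := andP theta01.
have h2 : 0 < (2 * h)^-1 by rewrite invr_gt0 mulr_gt0.
exists (theta `^ (2 * h)^-1).
  rewrite powR_ge0/=.
  by rewrite /powR gt_eqF// expR_lt1 pmulr_rlt0// ln_lt0// t0 t1.
move=> x; exists (Num.sqrt (theta * mass pi x)^-1) => t tp A.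
have tx0 : 0 < theta * mass pi x by rewrite mulr_gt0.
set D := _ - _.
suff D2 : D ^+ 2 <= (theta * mass pi x)^-1 * theta `^ (t / h).
  rewrite -(@ler_pXn2r _ 2) ?nnegrE ?mulr_ge0 ?sqrtr_ge0 ?powR_ge0//.
  rewrite real_normK ?num_real// exprMn sqr_sqrtr ?invr_ge0 ?(ltW tx0)//.
  rewrite -powRrM -[(theta `^ _) ^+ 2]powR_mulrn ?powR_ge0// -powRrM.
  have -> : (2 * h)^-1 * t * 2 = t / h by field; rewrite gt_eqF.
  exact: D2.
pose n := Num.truncn (t / h).
have th0 : 0 <= t / h by rewrite divr_ge0 ?ltW.
have /andP[nt tn] := truncn_itv th0.
pose s := t - n%:R * h.
have s0 : 0 <= s by rewrite subr_ge0 -ler_pdivlMr.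
have := l2_decay A n s0; rewrite /s addrC subrK.
have := @sum_le_mean _ pi (fun x => (fine (P t x A) - fine (pi A)) ^+ 2) [:: x] isT.
rewrite big_seq1 -/D => H1 H2.
have {H1 H2} HD : mass pi x * D ^+ 2 <= theta ^+ n.
  apply: le_trans H2; apply: H1 => [|y]; last exact: sqr_ge0.
  by apply/bdd_sqr/bddB; [exact: bdd_prob|exact: bdd_cst].
rewrite ler_pdivlMl// -mulrA (le_trans (ler_wpM2l (ltW t0) HD))//.
rewrite -exprS -powR_mulrn ?(ltW t0)//.
apply: ger_powR; last exact: ltW.
by rewrite t0 ltW.
Qed.

End decay.

(** * Probabilities on the states given by a weight *)

Section discrete_measure.
Context {R : realType} (w : state -> R).

(** The absolute value makes this a measure for every [w], so that no proof
    has to be carried by the definition. *)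
Definition discrete_measure (A : set state) : \bar R :=
  (\esum_(x in A) `|w x|%:E)%E.

Let w0 x : (0 <= `|w x|%:E)%E. Proof. by rewrite lee_fin. Qed.

Let discrete0 : discrete_measure set0 = 0%E.
Proof. exact: esum_set0. Qed.

Let discrete_ge0 A : (0 <= discrete_measure A)%E.
Proof. by apply: esum_ge0 => x _. Qed.

Let discrete_sigma_additive : semi_sigma_additive discrete_measure.
Proof.
move=> F mF tF mUF; rewrite /discrete_measure nneseries_sum_bigcup//.
apply: is_cvg_nneseries => n _ _; exact: discrete_ge0.
Qed.

HB.instance Definition _ := isMeasure.Build _ _ _ discrete_measure
  discrete0 discrete_ge0 discrete_sigma_additive.

(** The point mass is a default value for weights of total mass 0 or infinite. *)
Definition discrete_prob : probability state R :=
  mnormalize discrete_measure (dirac (0, 0)%N).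

Lemma discrete_prob_mass (M : R) : (forall x, 0 <= w x) ->
  (forall N, \sum_(x <- box N) w x <= M) -> 0 < w (0, 0)%N ->
  exists2 c, 0 < c & forall x, mass discrete_prob x = c * w x.
Proof.
move=> wge0 wM wo.
have tot_le : (discrete_measure setT <= M%:E)%E.
  apply: ge_ereal_sup => _ [A [finA _] <-].
  rewrite fsbig_finite//= sumEFin lee_fin.
  pose N := (\max_(x <- finmap.enum_fset (fset_set A)) maxn x.1 x.2).+1.
  apply: le_trans (wM N).
  under eq_bigr do rewrite ger0_norm//.
  apply: le_sum_subset => //; rewrite ?box_uniq ?finmap.fset_uniq// => x xA.
  have : (maxn x.1 x.2 < N)%N.
    by rewrite ltnS (@leq_bigmax_seq _ _ _ (fun x : state => maxn x.1 x.2)).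
  by rewrite gtn_max mem_box.
have point x : discrete_measure [set x] = (w x)%:E.
  by rewrite /discrete_measure esum_set1// ger0_norm.
have tot_gt0 : (0 < discrete_measure setT)%E.
  apply: (@lt_le_trans _ _ (discrete_measure [set (0, 0)%N])).
    by rewrite point lte_fin.
  by apply: le_measure => //; apply: mem_set; exact: measurable_state.
have tot_fin : discrete_measure setT \is a fin_num.
  by rewrite ge0_fin_numE ?ltW// (le_lt_trans tot_le)// ltry.
exists (fine (discrete_measure setT))^-1.
  by rewrite invr_gt0 fine_gt0// tot_gt0 -ge0_fin_numE// ltW.
move=> x; rewrite /mass /discrete_prob /= /mnormalize ifF; last first.
  by rewrite gt_eqF//=; apply/negbTE; move: tot_fin; rewrite fin_numE => /andP[].
transitivity (fine (discrete_measure [set x] *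
    (fine (discrete_measure setT))^-1%:E)%E) => //.
by rewrite point -EFinM /= mulrC.
Qed.

End discrete_measure.

(** * Rates and balanced weight of the gap process *)

Section jump_rates.
Context {R : realType}.
Implicit Types (jumps : state -> seq (state * R)).

Definition jump_rate jumps (x y : state) : R :=
  \sum_(j <- jumps x | j.1 == y) j.2.

Lemma sum_by_target (s : seq (state * R)) (B : seq state) (F : state -> R) :
  uniq B -> (forall j, j \in s -> j.1 \in B) ->
  \sum_(y <- B) F y * \sum_(j <- s | j.1 == y) j.2 =
  \sum_(j <- s) F j.1 * j.2.
Proof.
move=> uB sB; under eq_bigr do rewrite big_mkcond mulr_sumr.
rewrite exchange_big/= big_seq [RHS]big_seq; apply: eq_bigr => j js.
rewrite (bigD1_seq j.1) ?sB//= eqxx big1 ?addr0// => y /negbTE.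
by rewrite eq_sym => ->; rewrite mulr0.
Qed.

Lemma jump_rate_ge0 jumps x y : (forall j, j \in jumps x -> 0 <= j.2) ->
  0 <= jump_rate jumps x y.
Proof.
move=> j0; rewrite /jump_rate big_seq_cond; apply: sumr_ge0 => j /andP[+ _].
exact: j0.
Qed.

Lemma le_jump_rate jumps x j : (forall j, j \in jumps x -> 0 <= j.2) ->
  j \in jumps x -> j.2 <= jump_rate jumps x j.1.
Proof.
move=> j0 js; rewrite /jump_rate (perm_big _ (perm_to_rem js)) big_cons eqxx.
rewrite lerDl big_seq_cond; apply: sumr_ge0 => i /andP[+ _].
by move=> /mem_rem; exact: j0.
Qed.

Lemma jump_rate_neq0 jumps x y : jump_rate jumps x y != 0 ->
  exists2 j, j \in jumps x & j.1 = y.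
Proof.
move=> H; case: (boolP (has (fun j => j.1 == y) (jumps x))) => [/hasP[j js /eqP]|].
  by exists j.
move=> /hasPn nj; move: H; rewrite /jump_rate big_seq_cond big1 ?eqxx//.
by move=> j /andP[/nj/negbTE ->].
Qed.

End jump_rates.

Section gap.
Context {R : realType}.
Variables (delta lambda : R).
Hypotheses (delta0 : 0 <= delta) (lambda0 : 0 <= lambda).

Local Notation q := (jump_rate (gap_jumps delta lambda)).
Local Notation K := (4 + 2 * delta + lambda / 2).
Local Notation r := ((1 + delta) / (1 + lambda / 2)).
Local Notation s := ((1 + delta) ^+ 2 / (1 + lambda / 2)).

Lemma gap_jump_local x j : j \in gap_jumps delta lambda x ->
  [/\ 0 < j.2, j.1 != x, j.1 \in nbhd x & x \in nbhd j.1].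
Proof.
have d0 := delta0; have l0 := lambda0.
rewrite /nbhd !mem_box; case: x => [[|a] [|b]]; rewrite /= !inE;
  repeat (case/orP); move=> /eqP -> /=; rewrite ?xpair_eqE;
  split; try lia; lra.
Qed.

Lemma gap_jump_ge0 x j : j \in gap_jumps delta lambda x -> 0 <= j.2.
Proof. by case/gap_jump_local => /ltW. Qed.

Lemma exit_gap x : exit q x = \sum_(j <- gap_jumps delta lambda x) j.2.
Proof.
have := @sum_by_target _ (gap_jumps delta lambda x) (nbhd x) (fun=> 1) (nbhd_uniq x).
rewrite /exit; under eq_bigr do rewrite mul1r.
move=> ->; last by move=> j /gap_jump_local[].
by apply: eq_bigr => j _; rewrite mul1r.
Qed.

Lemma gap_local_rates : local_rates q K.
Proof.
have d0 := delta0; have l0 := lambda0; split=> [x y|x|x y /jump_rate_neq0[j]|x].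
- exact/jump_rate_ge0/gap_jump_ge0.
- apply/eqP; apply: contraT => /jump_rate_neq0[j /gap_jump_local[_ + _ _]].
  by move=> /eqP.
- by move=> /gap_jump_local[_ _ ? ?] <-.
- rewrite exit_gap; case: x => [[|a] [|b]]; rewrite !big_cons big_nil /=; lra.
Qed.

Lemma gap_rate_ge x j : j \in gap_jumps delta lambda x -> j.2 <= q x j.1.
Proof. exact/le_jump_rate/gap_jump_ge0. Qed.

Lemma gap_rate_up a b : 1 <= q (a, b) (a, b.+1).
Proof.
have d0 := delta0; case: a b => [|a] [|b].
- apply: le_trans (gap_rate_ge (j := ((0, 1)%N, 2 + 2 * delta)) _) => /=.
    lra.
  by rewrite !inE eqxx.
- apply: le_trans (gap_rate_ge (j := ((0, b.+2)%N, 1 + delta)) _) => /=.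
    lra.
  by rewrite !inE eqxx ?orbT.
- apply: le_trans (gap_rate_ge (j := ((a.+1, 1)%N, 2 + 2 * delta)) _) => /=.
    lra.
  by rewrite !inE eqxx ?orbT.
- apply: le_trans (gap_rate_ge (j := ((a.+1, b.+2)%N, 1 + delta)) _) => /=.
    lra.
  by rewrite !inE eqxx ?orbT.
Qed.

Lemma gap_rate_right a b : 1 <= q (a, b.+1) (a.+1, b).
Proof.
have d0 := delta0; case: a => [|a].
- apply: le_trans (gap_rate_ge (j := ((1, b)%N, 1 + delta)) _) => /=.
    lra.
  by rewrite !inE eqxx ?orbT.
- apply: le_trans (gap_rate_ge (j := ((a.+2, b)%N, 1 + delta)) _) => /=.
    lra.
  by rewrite !inE eqxx ?orbT.
Qed.

(** Decrease the second coordinate to 0, then trade one unit of the first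
    coordinate for one of the second. *)
Lemma gap_leads_to_origin : leads_to q (0, 0)%N.
Proof.
move=> Z Z0 Zq.
have step x j : j \in gap_jumps delta lambda x -> Z j.1 -> Z x.
  move=> js; apply: Zq; rewrite gt_eqF// (lt_le_trans _ (gap_rate_ge js))//.
  by case/gap_jump_local: js.
have down a b : Z (a, b) -> Z (a, b.+1).
  apply: (step _ ((a, b), 1 + lambda / 2)).
  by case: a => [|a]; rewrite !inE eqxx ?orbT.
suff H a : forall b, Z (a, b) by case.
elim: a => [|a ih]; elim=> [|b].
- by [].
- exact: down.
- by apply: (step _ ((a, 1)%N, 2)) => //=; rewrite !inE eqxx.
- exact: down.
Qed.

(** The jumps read backward, so that the balance equation at [y] is a sum over
    a short explicit list. *)
Definition gap_sources (y : state) : seq (state * R) :=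
  match y with
  | (0%N, 0%N) => [:: ((0%N, 1%N), 1 + lambda / 2)]
  | (0%N, 1%N) => [:: ((0%N, 0%N), 2 + 2 * delta);
                      ((0%N, 2%N), 1 + lambda / 2);
                      ((1%N, 0%N), 2)]
  | (0%N, b.+2) => [:: ((0%N, b.+1), 1 + delta);
                       ((0%N, b.+3), 1 + lambda / 2);
                       ((1%N, b.+1), 1)]
  | (a.+1, 0%N) => [:: ((a, 1%N), 1 + delta);
                       ((a.+1, 1%N), 1 + lambda / 2)]
  | (a.+1, 1%N) => [:: ((a, 2%N), 1 + delta);
                       ((a.+1, 2%N), 1 + lambda / 2);
                       ((a.+2, 0%N), 2);
                       ((a.+1, 0%N), 2 + 2 * delta)]
  | (a.+1, b.+2) => [:: ((a, b.+3), 1 + delta);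
                        ((a.+1, b.+3), 1 + lambda / 2);
                        ((a.+2, b.+1), 1);
                        ((a.+1, b.+1), 1 + delta)]
  end.

Lemma gap_rate_sources x y :
  q x y = \sum_(j <- gap_sources y | j.1 == x) j.2.
Proof.
rewrite /jump_rate big_mkcond [RHS]big_mkcond.
case: x => [[|a] [|b]]; case: y => [[|c] [|[|e]]];
  rewrite !big_cons !big_nil /= ?xpair_eqE ?eqSS /= ?andbF ?andbT ?addr0 ?add0r //;
  repeat (case: eqP => ? /=); (try lia); rewrite ?addr0 ?add0r //.
Qed.

Lemma gap_source_near y j : j \in gap_sources y -> j.1 \in nbhd y.
Proof.
rewrite /nbhd mem_box; case: y => [[|a] [|[|b]]]; rewrite /= !inE;
  repeat (case/orP); move=> /eqP -> /=; lia.
Qed.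

(** The product weight of the theorem, without its constant; the row
    [x.2 = 0] has half weight because both particles then sit together. *)
Definition gap_weight (x : state) : R :=
  weight s r x * (if x.2 == 0%N then 1 / 2 else 1).

Lemma gap_den_gt0 : 0 < 1 + lambda / 2.
Proof. by have l0 := lambda0; lra. Qed.

Lemma gap_r_ge0 : 0 <= r.
Proof. by rewrite divr_ge0 ?(ltW gap_den_gt0)// addr_ge0. Qed.

Lemma gap_s_ge0 : 0 <= s.
Proof. by rewrite divr_ge0 ?(ltW gap_den_gt0)// sqr_ge0. Qed.

Lemma gap_r_le_s : r <= s.
Proof.
rewrite ler_pM2r ?invr_gt0 ?gap_den_gt0// expr2 ler_peMr ?addr_ge0//.
by rewrite lerDl.
Qed.

Lemma gap_weight_ge0 x : 0 <= gap_weight x.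
Proof.
rewrite mulr_ge0//; last by case: ifP => // _; lra.
by rewrite mulr_ge0// exprn_ge0 ?gap_s_ge0 ?gap_r_ge0.
Qed.

(** Each balance equation is a rational identity in the parameters, one for
    each of the six shapes of the list of sources. *)
Lemma gap_weight_balanced : balanced q gap_weight.
Proof.
move=> y; rewrite /inflow.
under eq_bigr do rewrite gap_rate_sources.
rewrite sum_by_target ?nbhd_uniq//; last exact: gap_source_near.
rewrite exit_gap.
have p0 : 2 + lambda != 0 by have l0 := lambda0; rewrite gt_eqF//; lra.
case: y => [[|a] [|[|b]]]; rewrite !big_cons !big_nil /gap_weight /weight /=;
  rewrite ?exprS ?expr0; try (move: (s ^+ a) => S); try (move: (r ^+ b) => B);
  by field.
Qed.
End gap.

(** * The normalization constant and the shape of invariant probabilities *)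

Section gap_mass.
Context {R : realType}.
Variables (delta lambda : R).
Hypotheses (delta0 : 0 <= delta) (lambda0 : 0 <= lambda).

Local Notation q := (jump_rate (gap_jumps delta lambda)).
Local Notation r := ((1 + delta) / (1 + lambda / 2)).
Local Notation s := ((1 + delta) ^+ 2 / (1 + lambda / 2)).
Local Notation mu := (gap_weight delta lambda).

Lemma geometric_sumE (x : R) n : x != 1 ->
  \sum_(0 <= i < n) x ^+ i = (1 - x ^+ n) / (1 - x).
Proof.
move=> x1; have x1' : 1 - x != 0 by rewrite subr_eq0 eq_sym.
apply: (mulIf x1'); rewrite divfK// big_mkord mulrC.
by rewrite -opprB mulNr -subrX1 opprB.
Qed.

Lemma gap_weight_sum n : s < 1 ->
  \sum_(x <- box n.+1) mu x =
  (1 - s ^+ n.+1) * (1 + r - 2 * r ^+ n.+1) / (2 * (1 - s) * (1 - r)).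
Proof.
move=> s1; have r1 : r < 1 by exact: le_lt_trans (gap_r_le_s _ _) s1.
rewrite sum_box.
have E a : \sum_(0 <= b < n.+1) mu (a, b) =
    s ^+ a * (\sum_(0 <= b < n.+1) r ^+ b - 1 / 2).
  rewrite !big_nat_recl//= /gap_weight /weight /= !expr0 mulrBr mulrDr mulr1.
  rewrite mulr_sumr; under eq_bigr do rewrite mulr1.
  by move: (\sum_(_ <= _ < _) _) => S; field.
under eq_bigr do rewrite E.
rewrite -mulr_suml !geometric_sumE ?lt_eqF//.
move: (s ^+ n.+1) (r ^+ n.+1) s1 r1 => u v s1 r1; move: s r s1 r1 => S Q S1 Q1.
have S0 : 1 - S != 0 by rewrite gt_eqF// subr_gt0.
have Q0 : 1 - Q != 0 by rewrite gt_eqF// subr_gt0.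
by field; rewrite S0 Q0.
Qed.

(** The total mass of [gap_weight] when it is finite. *)
Definition gap_total : R := (1 + r) / (2 * (1 - s) * (1 - r)).

Lemma gap_weight_sum_bounds n : s < 1 ->
  gap_total - 4 / (2 * (1 - s) * (1 - r)) * s ^+ n.+1 <=
  \sum_(x <- box n.+1) mu x <= gap_total.
Proof.
move=> s1; rewrite gap_weight_sum// /gap_total.
have rs := gap_r_le_s delta0 lambda0.
have r0 := gap_r_ge0 delta0 lambda0.
have s0 := gap_s_ge0 delta lambda0.
have vu : r ^+ n.+1 <= s ^+ n.+1 by rewrite lerXn2r// nnegrE.
have u0 : 0 <= s ^+ n.+1 by rewrite exprn_ge0.
have v0 : 0 <= r ^+ n.+1 by rewrite exprn_ge0.
have u1 : s ^+ n.+1 <= s by rewrite exprS ler_piMr// exprn_ile1// ltW.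
have vr : r ^+ n.+1 <= r.
  by rewrite exprS ler_piMr// exprn_ile1// (le_trans rs (ltW s1)).
move: (s ^+ n.+1) (r ^+ n.+1) vu u0 v0 u1 vr => u v.
move: s r s1 rs r0 s0 => S Q S1 QS Q0 S0 vu u0 v0 uS vQ.
have D0 : 0 < (2 * (1 - S) * (1 - Q))^-1.
  by rewrite invr_gt0 !mulr_gt0// subr_gt0// (le_lt_trans QS).
rewrite [4 / _ * u]mulrAC -mulrBl !ler_pM2r//; apply/andP; split.
  have : 0 <= u * v by exact: mulr_ge0.
  have : 0 <= u * (1 - Q) by rewrite mulr_ge0// subr_ge0 (le_trans QS)// ltW.
  rewrite !mulrBr !mulrBl !mulrDr => *; lra.
have : 0 <= u * (1 + Q - 2 * v) by rewrite mulr_ge0//; lra.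
lra.
Qed.

Lemma gap_const_total : s < 1 -> gap_const delta lambda * gap_total = 1.
Proof.
move=> s1; have r1 := le_lt_trans (gap_r_le_s delta0 lambda0) s1.
have d0 := delta0; have l0 := lambda0; have p0 := gap_den_gt0 lambda0.
have sE : 1 - s = (lambda / 2 - 2 * delta - delta ^+ 2) / (1 + lambda / 2).
  by field; rewrite gt_eqF//; lra.
have rE : 1 - r = (lambda / 2 - delta) / (1 + lambda / 2).
  by field; rewrite gt_eqF//; lra.
have r'E : 1 + r = (lambda / 2 + delta + 2) / (1 + lambda / 2).
  by field; rewrite gt_eqF//; lra.
have : 0 < 1 - s by rewrite subr_gt0.
have : 0 < 1 - r by rewrite subr_gt0.
rewrite /gap_total /gap_const sE rE r'E.
rewrite !pmulr_lgt0 ?invr_gt0// => A B.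
move: A B; move: (lambda / 2) p0 l0 => l p0 l0 A B.
have e1 : l - delta != 0 by rewrite gt_eqF.
have e2 : l - 2 * delta - delta ^+ 2 != 0 by rewrite gt_eqF.
have e3 : l + delta + 2 != 0 by rewrite gt_eqF//; lra.
have e4 : 1 + l != 0 by rewrite gt_eqF.
by field; rewrite e4 e1 e2 e3.
Qed.

(** [balanced_unique] compares an invariant probability with [gap_weight]. The
    axis [x.2 = 0] alone would have infinite mass if [s] were at least 1;
    otherwise the total mass 1 fixes the constant. *)
Lemma gap_mass (pi : probability state R) : balanced q (mass pi) ->
  s < 1 /\ forall x, mass pi x = gap_const delta lambda * mu x.
Proof.
move=> bpi; have qK := gap_local_rates delta0 lambda0.
have qo := gap_leads_to_origin delta0 lambda0.
have pio := balanced_mass_gt0 qK qo bpi.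
have mu0 := gap_weight_ge0 delta0 lambda0.
have pi_le (B : seq state) : uniq B -> \sum_(x <- B) mass pi x <= 1.
  move=> uB; rewrite -(mean_cst pi 1); under eq_bigr do rewrite -[mass _ _]mulr1.
  by apply: sum_le_mean => //; exact: bdd_cst.
have muE x : mass pi x = 2 * mass pi (0, 0)%N * mu x.
  have muo : mu (0, 0)%N = 1 / 2 by rewrite /gap_weight /weight /= !mul1r.
  have := balanced_unique qK qo (mass_ge0 pi) mu0
    (fun N => pi_le _ (box_uniq N)) pio bpi
    (gap_weight_balanced delta0 lambda0) x.
  move=> ->; rewrite muo; field; rewrite gt_eqF//.
have s1 : s < 1.
  rewrite ltNge; apply/negP => s1.
  have H n : mass pi (0, 0)%N * n%:R <= 1.
    have u : uniq [seq (a, 0%N) | a <- iota 0 n].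
      by rewrite map_inj_uniq ?iota_uniq// => a b [].
    apply: le_trans (pi_le _ u); rewrite big_map.
    have -> : mass pi (0, 0)%N * n%:R = \sum_(a <- iota 0 n) mass pi (0, 0)%N.
      by rewrite big_const_seq count_predT size_iota iter_addr_0 mulr_natr.
    apply: ler_sum => a _; rewrite (muE (a, 0%N)) /gap_weight /weight /= expr0 mulr1.
    have : 1 <= s ^+ a by exact: exprn_ege1.
    move: (s ^+ a) (mass pi (0, 0)%N) pio => S m m0 S1; nra.
  have := H (Num.truncn (mass pi (0, 0)%N)^-1).+1.
  by rewrite leNgt mulrC -ltr_pdivrMr// div1r truncnS_gt.
split=> // x; rewrite muE; congr (_ * _).
set c := 2 * _ in muE *.
have c0 : 0 < c by rewrite mulr_gt0.
have cT : c * gap_total = 1.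
  apply/eqP; rewrite eq_le; apply/andP; split.
    apply/ler_addgt0Pr => e e0.
    have s01 : 0 <= s < 1 by rewrite gap_s_ge0.
    pose k := 4 / (2 * (1 - s) * (1 - r)).
    have [n Hn] := geometric_small (c * k) s01 e0.
    have /andP[lo _] := gap_weight_sum_bounds n s1.
    have {lo} := ler_wpM2l (ltW c0) lo; rewrite -/k mulrBr [c * (k * _)]mulrA.
    have : c * \sum_(x <- box n.+1) mu x <= 1.
      rewrite mulr_sumr (le_trans _ (pi_le _ (box_uniq n.+1)))//.
      by apply: ler_sum => y _; rewrite muE.
    move: Hn; move: (c * k * _) (c * \sum_(_ <- _) _) (c * gap_total) => *; lra.
  rewrite -(mean_cst pi 1); apply: mean_le_box => [|//|N]; first exact: bdd_cst.
  under eq_bigr do rewrite mulr1 muE.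
  rewrite -mulr_sumr ler_wpM2l ?(ltW c0)//.
  apply: (@le_trans _ _ (\sum_(x <- box N.+1) mu x)).
    by apply: le_sum_subset => //; rewrite ?box_uniq//; exact: box_mono.
  by case/andP: (gap_weight_sum_bounds N s1).
have T0 : gap_total != 0.
  by apply/eqP => T0; move: cT; rewrite T0 mulr0 => /esym/eqP; rewrite oner_eq0.
by apply: (mulIf T0); rewrite cT gap_const_total.
Qed.

End gap_mass.

(** * Markov chains with given jumps; ergodicity of the gap process *)

Section markov.
Context {R : realType} {d : measure_display} {Omega : measurableType d}.
Variables (Pr : state -> probability Omega R) (X : R -> {mfun Omega >-> state}).

(** The Markov property for the sure event is the Chapman-Kolmogorov
    equation. *)
Lemma markov_transition (jumps : state -> seq (state * R)) :
  (forall x, exit (jump_rate jumps) x = \sum_(j <- jumps x) j.2) ->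
  is_markov_chain jumps Pr X ->
  transition_function (jump_rate jumps) (law Pr X).
Proof.
move=> exitE [start markov gen]; split.
- by move=> x; apply: EFin_inj; rewrite EFin_prob; exact: start.
- move=> s t x A s0 t0.
  have pastT : past X s setT.
    by rewrite /past; exact: (@measurableT _ (g_sigma_algebraType _)).
  have := markov x s t setT A s0 t0 pastT (measurable_state A).
  rewrite setTI => E; rewrite [LHS]E.
  rewrite ge0_integral_distribution// => _ Y _; exact: measurable_state.
- move=> x y; have := gen x y; rewrite /generator -exitE.
  by case: eqP => _; rewrite ?mul1r ?mul0r.
Qed.

Lemma stationaryP (pi : probability state R) :
  stationary Pr X pi <-> invariant (law Pr X) pi.
Proof.
have E t (A : set state) : (mean pi (fun x => fine (law Pr X t x A)))%:E =
    (\int[pi]_x law Pr X t x A)%E.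
  rewrite EFin_mean; last exact: bdd_prob.
  by apply: eq_integral => x _; rewrite EFin_prob.
split=> [st t A t0|inv t A t0 _].
  by apply: EFin_inj; rewrite E (st _ _ t0 (measurable_state A)) EFin_prob.
by rewrite -E inv// EFin_prob.
Qed.

Lemma tv_dist_leP (mu nu : probability state R) (c : R) :
  (tv_dist mu nu <= c%:E)%E <->
  forall A : set state, `|fine (mu A) - fine (nu A)| <= c.
Proof.
have E (A : set state) : `|mu A - nu A|%E = `|fine (mu A) - fine (nu A)|%:E.
  by rewrite -[in LHS](EFin_prob mu) -[in LHS](EFin_prob nu).
split=> [H A|H].
  rewrite -lee_fin -E; apply: le_trans H; apply: ereal_sup_ubound.
  by exists A => //; exact: measurable_state.
by apply: ge_ereal_sup => _ [A _ <-]; rewrite E lee_fin.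
Qed.

Lemma converges_exponentiallyP (pi : probability state R) (rho : R) :
  converges_exponentially Pr X pi rho <-> exponential_rate (law Pr X) pi rho.
Proof.
split=> H x; have [C HC] := H x; exists C => t t0.
  by move=> A; move/tv_dist_leP: (HC t t0); exact.
by apply/tv_dist_leP => A; exact: HC.
Qed.

End markov.

Section gap_ergodicity.
Context {R : realType}.
Variables (delta lambda : R).
Hypotheses (delta0 : 0 <= delta) (lambda0 : 0 <= lambda).
Variable P : R -> state -> probability state R.
Hypothesis Pq : transition_function (jump_rate (gap_jumps delta lambda)) P.

Local Notation q := (jump_rate (gap_jumps delta lambda)).
Local Notation K := (4 + 2 * delta + lambda / 2).
Local Notation r := ((1 + delta) / (1 + lambda / 2)).
Local Notation s := ((1 + delta) ^+ 2 / (1 + lambda / 2)).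
Local Notation mu := (gap_weight delta lambda).

(** Moving right takes two jumps, up and then diagonally, so the time is
    twice the one in which a single jump has probability bounded below. *)
Lemma gap_mass_bounds : exists h : R, exists2 eps : R, 0 < h /\ 0 < eps &
  forall x, [/\ eps <= mass (P h x) x, eps <= mass (P h x) (x.1.+1, x.2)
    & eps <= mass (P h x) (x.1, x.2.+1)].
Proof.
have d0 := delta0; have l0 := lambda0.
have qK := gap_local_rates delta0 lambda0.
have K4 : 4 <= K by lra.
have Kp : 0 < K by lra.
(* [K h = 1 / 2], so that a jump of rate at least 1 has probability at least
   [h * (1 - 1 / 2) ^+ 2] *)
pose h : R := (2 * K)^-1; pose e := h / 4.
have h0 : 0 < h by rewrite invr_gt0 mulr_gt0.
have h00 := ltW h0.
have Kh : K * h = 1 / 2 by rewrite /h; field; rewrite gt_eqF//; lra.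
have e0 : 0 < e by rewrite divr_gt0.
have h1 : h <= 1 by rewrite /h invf_le1 ?mulr_gt0//; lra.
have stay x : 1 / 2 <= mass (P h x) x.
  apply: le_trans (mass_stay_ge qK Pq x h00).
  have : exit q x * h <= K * h by rewrite ler_wpM2r//; case: qK.
  by rewrite Kh; lra.
have jump x y : x != y -> 1 <= q x y -> e <= mass (P h x) y.
  move=> xy qxy; have Kh1 : K * h <= 1 by rewrite Kh; lra.
  apply: le_trans (mass_jump_ge qK Pq h00 Kh1 xy).
  rewrite Kh /e mulrAC; have : h * 1 <= h * q x y by rewrite ler_wpM2l.
  rewrite expr2; move: (q x y) => Q; lra.
have up x : e <= mass (P h x) (x.1, x.2.+1).
  case: x => a b; apply: jump; last exact: gap_rate_up.
  by rewrite /= xpair_eqE; lia.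
have right x : e <= mass (P h (x.1, x.2.+1)) (x.1.+1, x.2).
  case: x => a b; apply: jump; last exact: gap_rate_right.
  by rewrite /= xpair_eqE; lia.
have e14 : e <= 1 / 4 by rewrite /e; lra.
have step x y z := mass_step1 Pq x y z h00 h00.
exists (h + h); exists (e * e); first by rewrite addr_gt0// mulr_gt0.
move=> x; split.
- apply: le_trans (step x x x); have := stay x.
  by move: (mass _ _) => m *; apply: ler_pM; rewrite ?(ltW e0)//; lra.
- apply: le_trans (step _ _ (x.1, x.2.+1)).
  by apply: ler_pM; rewrite ?(ltW e0).
- apply: le_trans (step x _ x).
  apply: ler_pM; rewrite ?(ltW e0)//.
  by have := stay x; lra.
Qed.

Lemma gap_exponential : s < 1 ->
  exists2 pi : probability state R, balanced q (mass pi) &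
  exists2 rho, 0 <= rho < 1 & exponential_rate P pi rho.
Proof.
move=> s1; have d0 := delta0; have l0 := lambda0.
have s0 := gap_s_ge0 delta lambda0; have r0 := gap_r_ge0 delta0 lambda0.
have r1 := le_lt_trans (gap_r_le_s delta0 lambda0) s1.
have qK := gap_local_rates delta0 lambda0.
have mu0 := gap_weight_ge0 delta0 lambda0.
have sp : 0 < s by rewrite divr_gt0 ?gap_den_gt0// exprn_gt0//; lra.
have rp : 0 < r by rewrite divr_gt0 ?gap_den_gt0//; lra.
have wp x : 0 < weight s r x by rewrite mulr_gt0 ?exprn_gt0.
have mu_le N : \sum_(x <- box N) mu x <= gap_total delta lambda.
  apply: (@le_trans _ _ (\sum_(x <- box N.+1) mu x)).
    by apply: le_sum_subset => //; rewrite ?box_uniq//; exact: box_mono.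
  by case/andP: (gap_weight_sum_bounds delta0 lambda0 N s1).
have muo : 0 < mu (0, 0)%N by rewrite /gap_weight /weight /=; lra.
have [c c0 piE] := discrete_prob_mass mu0 mu_le muo.
set pi := discrete_prob _ in piE.
have bpi : balanced q (mass pi).
  rewrite (_ : mass pi = fun x => c * mu x); last exact/funext.
  exact/balancedZ/gap_weight_balanced.
exists pi => //.
have pi_bounds x : c / 2 * weight s r x <= mass pi x <= c * weight s r x.
  rewrite piE /gap_weight; have := wp x; move: (weight _ _ _) => w w0.
  by case: ifP => _; apply/andP; split; nra.
have c20 : 0 < c / 2 by rewrite divr_gt0.
have ipi := balanced_invariant qK Pq bpi.
have [h [eps [h0 eps0] Ph]] := gap_mass_bounds.
have s01 : 0 <= s < 1 by rewrite s0.
have r01 : 0 <= r < 1 by rewrite r0.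
(* the summand 1 makes [k] positive, as [exponential_decay] requires *)
pose k := c / (c / 2) * hardy_const s r + 1.
have k0 : 0 < k.
  rewrite ltr_wpDl// mulr_ge0 ?hardy_const_ge0//.
  by rewrite divr_ge0 ?ltW.
apply: (exponential_decay Pq ipi h0 eps0 k0 Ph) => [g bg mg|x].
  apply: le_trans (poincare s01 r01 c20 pi_bounds bg mg) _.
  rewrite ler_wpM2r ?lerDl//; exact/mean_ge0/grad2_ge0.
by have /andP[+ _] := pi_bounds x; apply: lt_le_trans; rewrite mulr_gt0.
Qed.

End gap_ergodicity.

Lemma gap_s_lt1 (R : realType) (delta lambda : R) : 0 <= lambda ->
  ((1 + delta) ^+ 2 / (1 + lambda / 2) < 1) =
  (2 * delta ^+ 2 + 4 * delta < lambda).
Proof.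
move=> l0; rewrite ltr_pdivrMr ?gap_den_gt0// mul1r.
by rewrite !expr2; apply/idP/idP => ?; lra.
Qed.

(** * Exponential ergodicity and the stationary measure *)

Unset Implicit Arguments.

Theorem theorem6 (R : realType) (d : measure_display) (Omega : measurableType d)
    (Pr : state -> probability Omega R) (G : R -> {mfun Omega >-> state})
    (delta lambda : R) (hdelta : 0 <= delta) (hlambda : 0 <= lambda)
    (hG : is_gap_process delta lambda Pr G) :
  (exponentially_ergodic Pr G <-> lambda > 2 * delta ^+ 2 + 4 * delta) /\
  (forall pi2 : probability state R, stationary Pr G pi2 ->
    let C := gap_const delta lambda in
    let r := (1 + delta) / (1 + lambda / 2) in
    let s := (1 + delta) ^+ 2 / (1 + lambda / 2) in
    [/\ pi2 [set (0%N, 0%N)] = (C / 2)%:E,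
        forall y : nat, (1 <= y)%N -> pi2 [set (0%N, y)] = (C * r ^+ y)%:E,
        forall x : nat, (1 <= x)%N -> pi2 [set (x, 0%N)] = (C / 2 * s ^+ x)%:E
      & forall x y : nat, (1 <= x)%N -> (1 <= y)%N ->
          pi2 [set (x, y)] = (C * s ^+ x * r ^+ y)%:E]).
Proof.
have Pq := markov_transition (exit_gap hdelta hlambda) hG.
have qK := gap_local_rates hdelta hlambda.
have mass_of pi : invariant (law Pr G) pi -> _ :=
  fun ipi => gap_mass hdelta hlambda (invariant_balanced qK Pq ipi).
split; last first.
  move=> pi2 /stationaryP/mass_of[_ piE] C r s.
  have pointE x : pi2 [set x] = (C * gap_weight delta lambda x)%:E.
    by rewrite -piE /mass EFin_prob.
  split=> [|[|y] // _|[|x] // _|[|x] [|y] // _ _]; rewrite pointE;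
    congr EFin; rewrite /gap_weight /weight /= ?expr0 -/r -/s; ring.
split=> [[pi [rho r01 /converges_exponentiallyP rate] _]|].
  rewrite -gap_s_lt1//.
  by have [] := mass_of pi (exponential_rate_invariant Pq r01 rate).
rewrite -gap_s_lt1// => s1.
have [pi _ [rho r01 rate]] := gap_exponential hdelta hlambda Pq s1.
exists pi.
  by exists rho => //; exact/converges_exponentiallyP.
move=> pi' [rho' r01' /converges_exponentiallyP rate'] A _.
rewrite -[LHS]EFin_prob -[RHS]EFin_prob.
by rewrite (exponential_rate_unique r01 r01' rate rate').
Qed.
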